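(* Let $a,b,c,d$ be integers with $a^2=4d$, and let $n\ge 3$, $m\ge 2$ be integers. Put $f(x)=x^n+ax^{n-1}+dx^{n-2}+b$. Consider the differential equation for $y=y(x)$ $$\Big(\frac{d^m}{dx^m}+c\Big)^n y+a\Big(\frac{d^m}{dx^m}+c\Big)^{n-1}y+d\Big(\frac{d^m}{dx^m}+c\Big)^{n-2}y+by=0 .\qquad ( * )$$ Suppose its auxiliary polynomial $$\mathcal{F}(z)=(z^m+c)^n+a(z^m+c)^{n-1}+d(z^m+c)^{n-2}+b$$ is irreducible over $\mathbb{Q}$ and has a root $\theta$ such that $K=\mathbb{Q}(\theta)$ is the splitting field of $\mathcal{F}$. Suppose that each prime $p$ dividing the discriminant $D_{\mathcal{F}}$ of $\mathcal{F}(z)$ satisfies one of the following conditions: (i) $p\mid b$ and $p^2\nmid b$; (ii) $p\nmid b$ and $p\mid m$, and, writing $m=p^js$ with $j\ge 1$ and $p\nmid s$, the polynomials $$(x^s+c)^n+a(x^s+c)^{n-1}+d(x^s+c)^{n-2}+b$$ and $$\frac1p\, n(x^s+c)^{p^j(n-1)}t(x)+\frac1p\Big\{(-1)^{p^j}\big(a(x^s+c)^{n-1}+d(x^s+c)^{n-2}+b\big)^{p^j}+a(x^m+c)^{n-1}+d(x^m+c)^{n-2}+b\Big\}$$ are coprime modulo $p$, where $t(x)=\sum_{i=1}^{p^j}\binom{p^j}{i}(x^s+c)^{p^j-i}(-c)^i+c$; (iii) $p\nmid bm$ and $p\mid d$, and, writing $n=sp^k$ with $k\ge 0$ and $p\nmid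 s$: (a) if $k\ge 1$, then either ($p\mid a_1$ and $p\nmid b_1$) or $p\nmid a_1\big((-b_1)^n-a_1^n(-b)^{n-1}\big)$, where $b_1=\frac{b+(-b)^{p^k}}{p}$ and $a_1=\frac ap$; (b) if $k=0$, then $p^2\nmid f(c)$; (iv) $p=2$, $2\nmid dbm$, and $b\equiv 1\pmod 4$; (v) $p\nmid abm$, $p^2\nmid f(c)$, and $p^2\nmid\big\{(-n)^nb+4(n-2)^{n-2}(a/2)^n\big\}$. Then the general solution of $( * )$ is of the form $$y(x)=\sum_{i=1}^{mn}\alpha_i\prod_{j=1}^{mn}e^{c_{j-1}^{(i)}\theta^{j-1}x},$$ where the $c_{j-1}^{(i)}$ are integers and the $\alpha_i$ are arbitrary real constants, for all $1\le i,j\le mn$.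
   Context: Two polynomials in $\mathbb{Z}[x]$ are coprime modulo $p$ if their reductions are coprime in $(\mathbb{Z}/p\mathbb{Z})[x]$. Here $f(c)=c^n+ac^{n-1}+dc^{n-2}+b$. In $( * )$ the expression $\frac{d^m}{dx^m}$ is the $m$-th derivative operator, and powers of $\big(\frac{d^m}{dx^m}+c\big)$ denote repeated composition of this operator; outside this symbol, $d$ is the integer coefficient.
   Formalization: The constants α_i are taken complex, for complex-valued solutions; real α_i are claimed to give all real solutions only when θ is real. For non-real θ real constants do not suffice: for F=z^8+1, Im e^{θx} is a solution that is not a real combination. *)

(* Defs.v *)
From HB Require Import structures.
From mathcomp Require Import all_boot all_order all_algebra.
From mathcomp Require Import complex.
From mathcomp Require Import all_classical all_reals all_analysis.

Set Implicit Arguments.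
Unset Strict Implicit.
Unset Printing Implicit Defensive.

Import Order.TTheory GRing.Theory Num.Theory.

Local Open Scope classical_set_scope.
Local Open Scope ring_scope.

(* Every use of [%/] on int below is an exact division under the hypotheses
   under which it occurs. *)

Section Arithmetic.

Implicit Types (a b c d : int) (m n p s j k : nat).

Definition f_poly a b d n : {poly int} :=
  'X^n + a *: 'X^(n.-1) + d *: 'X^(n - 2) + b%:P.

(* f(x^k + c) *)
Definition aux_poly a b c d n k : {poly int} :=
  let g : {poly int} := 'X^k + c%:P in
  g ^+ n + a *: g ^+ n.-1 + d *: g ^+ (n - 2) + b%:P.

(* The leading coefficient is nonzero in characteristic 0, so [p^`()] has degree
   exactly deg p - 1 and the Sylvester matrix has its usual size. *)
Definition discriminant (p : {poly int}) : int :=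
  let N := (size p).-1 in
  (((-1) ^+ 'C(N, 2) * resultant p p^`()) %/ lead_coef p)%Z.

Definition irreducible_over_Q (p : {poly int}) : Prop :=
  irreducible_poly (map_poly intr p : {poly rat}).

Definition coprime_modp p (P Q : {poly int}) : bool :=
  coprimep (map_poly intr P : {poly 'F_p}) (map_poly intr Q : {poly 'F_p}).

Definition divp_int p (P : {poly int}) : {poly int} :=
  map_poly (fun z : int => (z %/ p%:Z)%Z) P.

Definition t_poly c s p j : {poly int} :=
  \sum_(1 <= i < (p ^ j).+1)
     ('X^s + c%:P) ^+ (p ^ j - i) * ((- c) ^+ i)%:P *+ 'C(p ^ j, i)
  + c%:P.

(* [m] is p^j * s.  For p prime, p divides all coefficients: t = 0 and
   (-1)^{p^j} u(x^s)^{p^j} + u(x^m) = 0 modulo p, by Frobenius. *)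
Definition second_poly a b c d n m s p j : {poly int} :=
  let u k : {poly int} :=
    a *: ('X^k + c%:P) ^+ n.-1 + d *: ('X^k + c%:P) ^+ (n - 2) + b%:P in
  divp_int p
    (('X^s + c%:P) ^+ (p ^ j * n.-1) * t_poly c s p j *+ n
     + ((-1) ^+ (p ^ j) * u s ^+ (p ^ j) + u m)).

Definition cond_i b p : Prop :=
  (p %| b)%Z /\ ~~ ((p ^ 2)%N %| b)%Z.

Definition cond_ii a b c d n m p : Prop :=
  [/\ ~~ (p %| b)%Z, (p %| m)%N &
    exists j s : nat,
      [/\ (1 <= j)%N, ~~ (p %| s)%N, m = (p ^ j * s)%N &
          coprime_modp p (aux_poly a b c d n s)
                         (second_poly a b c d n m s p j)]].

Definition cond_iii a b c d n m p : Prop :=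
  [/\ ~~ (p %| b * m%:Z)%Z, (p %| d)%Z &
    exists s k : nat,
      [/\ ~~ (p %| s)%N, n = (s * p ^ k)%N,
          (1 <= k)%N ->
            let b1 := ((b + (- b) ^+ (p ^ k)) %/ p%:Z)%Z in
            let a1 := (a %/ p%:Z)%Z in
            ((p %| a1)%Z /\ ~~ (p %| b1)%Z) \/
            ~~ (p %| a1 * ((- b1) ^+ n - a1 ^+ n * (- b) ^+ n.-1))%Z &
          k = 0%N -> ~~ ((p ^ 2)%N %| (f_poly a b d n).[c])%Z]].

Definition cond_iv b d m p : Prop :=
  [/\ p = 2, ~~ (2 %| d * b * m%:Z)%Z & (b = 1 %[mod 4])%Z].

Definition cond_v a b c d n m p : Prop :=
  [/\ ~~ (p %| a * b * m%:Z)%Z,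
      ~~ ((p ^ 2)%N %| (f_poly a b d n).[c])%Z &
      ~~ ((p ^ 2)%N %| (- n%:Z) ^+ n * b
                       + 4 * (n%:Z - 2) ^+ (n - 2) * (a %/ 2)%Z ^+ n)%Z].

Definition disc_primes_condition a b c d n m : Prop :=
  forall p, prime p -> (p %| discriminant (aux_poly a b c d n m))%Z ->
    cond_i b p \/ cond_ii a b c d n m p \/ cond_iii a b c d n m p \/
    cond_iv b d m p \/ cond_v a b c d n m p.

End Arithmetic.

Section Complex.

Local Open Scope complex_scope.

Variable R : realType.
Local Notation C := R[i].

Definition croot (p : {poly int}) (z : C) : Prop := root (map_poly intr p) z.

(* The smallest subfield of C containing S, i.e. Q(S). *)
Definition adjoin_Q (S : set C) : set C :=
  smallest (fun K : set C => divring_closed (mem K)) S.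

Definition is_splitting_field (p : {poly int}) (K : set C) : Prop :=
  K = adjoin_Q [set z | croot p z].

Definition cexp (z : C) : C :=
  (expR (complex.Re z) * cos (complex.Im z))
    +i* (expR (complex.Re z) * sin (complex.Im z)).

(* Functions of a real variable with complex values are differentiated through
   their real and imaginary parts: R[i] carries no library structure of normed
   space over R. *)
Definition cderivable (y : R -> C) (x : R) : Prop :=
  derivable (@complex.Re R \o y) x 1 /\ derivable (@complex.Im R \o y) x 1.

Definition cderive (y : R -> C) : R -> C :=
  fun x => derive1 (@complex.Re R \o y) x +i* derive1 (@complex.Im R \o y) x.

Definition cderiven (k : nat) (y : R -> C) : R -> C := iter k cderive y.

(* d^m/dx^m + c *)
Definition diff_op (m : nat) (c : int) (y : R -> C) : R -> C :=
  fun x => cderiven m y x + c%:~R * y x.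

Definition diff_op_pow (m : nat) (c : int) (k : nat) (y : R -> C) : R -> C :=
  iter k (diff_op m c) y.

(* [cderive] is total, so differentiability up to the order m * n of the
   equation is required explicitly. *)
Definition is_solution (a b c d : int) (n m : nat) (y : R -> C) : Prop :=
  (forall k, (k < m * n)%N -> forall x, cderivable (cderiven k y) x) /\
  (forall x, diff_op_pow m c n y x
             + a%:~R * diff_op_pow m c n.-1 y x
             + d%:~R * diff_op_pow m c (n - 2) y x
             + b%:~R * y x = 0).

(* sum_i alpha_i prod_j exp (c_j^{(i)} theta^j x), with 0-based indices *)
Definition exp_form (N : nat) (theta : C) (cc : 'I_N -> 'I_N -> int)
    (alpha : 'I_N -> C) (x : R) : C :=
  \sum_(i < N) alpha i *
    \prod_(j < N) cexp ((cc i j)%:~R * theta ^+ j * x%:C).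

(* "The general solution is sum_i alpha_i prod_j exp (cc i j theta^j x) with
   arbitrary constants alpha_i": the integers cc are chosen once and for all,
   and the functions of this form are exactly the solutions.  Real constants
   alpha_i give the general real solution when theta is real.  When theta is not
   real the exponentials are complex-valued and the constants have to be
   complex: y^(8) + y = 0 has the real solution Re (exp (zeta x)), zeta a
   primitive 16th root of unity, which is not a real combination of the
   exponentials. *)
Definition general_solution_of_exp_form (a b c d : int) (n m : nat)
    (theta : C) : Prop :=
  exists cc : 'I_(m * n) -> 'I_(m * n) -> int,
    (forall y : R -> C,
       is_solution a b c d n m y <->
       exists alpha : 'I_(m * n) -> C,
         forall x, y x = exp_form theta cc alpha x) /\
    (complex.Im theta = 0 ->
     forall y : R -> R,
       is_solution a b c d n m (fun x => (y x)%:C) <->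
       exists alpha : 'I_(m * n) -> R,
         forall x, (y x)%:C = exp_form theta cc (fun i => (alpha i)%:C) x).

End Complex.

(* Main.v *)
Require Import Defs.
From HB Require Import structures.
From mathcomp Require Import all_boot all_order all_algebra.
From mathcomp Require Import complex.
From mathcomp Require Import all_classical all_reals all_analysis.
From mathcomp Require Import all_field zify ring.

Set Implicit Arguments.
Unset Strict Implicit.
Unset Printing Implicit Defensive.

Import Order.TTheory GRing.Theory Num.Theory.
Import numFieldNormedType.Exports.

Local Open Scope classical_set_scope.
Local Open Scope ring_scope.

(** Write [a = 2 e], [d = e^2] and [f(w) = w^(n-2) (w + e)^2 + b], so that
    [F(z) = f(z^m + c)].

    Everything rests on the fact that the roots of [F] lie in [Z[theta]], not only
    in [Q(theta)].  If [r_i = sum_j c_j theta^j] with integers [c_j], then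
    [exp (r_i x)] is the product of the [exp (c_j theta^j x)]; and as [F] has
    simple roots, the solutions of [F(d/dx) y = 0] are the combinations of the
    [exp (r_i x)] ([simple_roots_solution]).

    A root of [F] is an algebraic integer of [Q(theta)], and the hypotheses make
    [Z[theta]] the full ring of integers.  This is Dedekind's criterion: [F]
    is regular at p if it is outside the square of every maximal ideal [(p, G)]
    of [Z[x]], and then no algebraic integer of [Q(theta)] needs the denominator p
    ([regular_divide], [integral_denominator]).  Under each condition, [F] in the
    square of [(p, G)] would put into that square, or into [(p, G)], an element
    that the condition keeps out ([regular_i] to [regular_v]); at the other
    primes, a Bezout relation between [F], [F'] and the discriminant does it
    ([regular_ndisc]).

    Condition (i) has one gap: for n = 3 the factor [w] of [f - b] is simple, and
    regularity does not follow when p does not divide e.  This is where the hypothesis that [Q(theta)] is the splitting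
    field of [F] matters: it excludes this case ([cubic_dvd]).  Suppose that p
    exactly divides b and does not divide e.  The difference product delta of the
    three roots of [f] lies in [Q(theta)], and [delta^2 = b (4 e^3 - 27 b)].
    - If p is odd, delta is irrational, since p exactly divides its square.  Then
      the degree 3 m of [Q(theta)] is even, hence m and the discriminant of [F]
      are even, and (i) or (ii) holds at 2; under (i), e is even by the case
      p = 2 below.  It follows that [F] is regular at 2 and that [Q(delta)] is
      quadratic and unramified at 2.  Over this field an odd multiple of [F] is a
      norm [A^2 + A B - k B^2], with [A] and [B] coprime modulo 2 by regularity.  Modulo 2, [F] is a polynomial in [z^m], and square roots of
      such an identity can be taken forever ([norm_form_descent]).
    - If p = 2, then 4 divides [f(2)].  Substituting 2 for [theta^m + c] modulo 4 in
      a factorization of [F] over the cubic field gives a polynomial that is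
      regular at 2, is modulo 4 a product of two factors of degree m, and is modulo
      2 the square of a polynomial in [z^m]; a similar descent applies
      ([two_dvd_e], [split_square_descent]). *)

(** * The ideals (p, G) of Z[x] and their squares *)

Notation redp p := (map_poly (intr : int -> 'F_p)).

Section Reduction.
Variable p : nat.
Hypothesis pr : prime p.

Lemma intr_Fp_eq0 (z : int) : ((z%:~R : 'F_p) == 0) = (p %| z)%Z.
Proof.
rewrite dvdzE /= (dvdn_pcharf (pchar_Fp pr)).
by case: z => n //=; rewrite NegzE mulrNz oppr_eq0.
Qed.

Lemma redp_eq0P (x : {poly int}) :
  reflect (exists y, x = p%:R * y) (redp p x == 0).
Proof.
apply: (iffP eqP) => [x0|[y ->]]; last first.
  by rewrite rmorphM rmorph_nat -polyC_natr /= pchar_Fp_0 // mul0r.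
have dv i : (p %| x`_i)%Z.
  by rewrite -intr_Fp_eq0 -(coef_map (intr : {rmorphism int -> 'F_p})) x0 coef0.
exists (\poly_(i < size x) (x`_i %/ p)%Z); apply/polyP => i.
rewrite mulr_natl coefMn coef_poly.
case: ltnP => [_|/(nth_default 0)->]; last by rewrite mul0rn.
by rewrite -[LHS](divzK (dv i)) -mulr_natr natz.
Qed.

Lemma redp_eqP (x z : {poly int}) :
  redp p x = redp p z -> exists y, x = z + p%:R * y.
Proof.
move=> /eqP; rewrite -subr_eq0 -rmorphB => /redp_eq0P[y e].
by exists y; rewrite -e addrC subrK.
Qed.

Lemma redp_surj (y : {poly 'F_p}) : exists x : {poly int}, redp p x = y.
Proof.
exists (\poly_(i < size y) (val y`_i)%:Z).
apply/polyP => i; rewrite coef_map coef_poly /=.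
case: ltnP => [_|/(nth_default 0)->]; last by rewrite rmorph0.
by rewrite -pmulrn natr_Zp.
Qed.

Variable G : {poly int}.
Hypothesis irG : irreducible_poly (redp p G).

(** The ideal (p, G) is described by divisibility modulo p, so that it is prime
    because [G] is irreducible there.  For its square no such description exists,
    and generators are used. *)
Definition inI (x : {poly int}) := redp p G %| redp p x.
Definition inI2 (x : {poly int}) :=
  exists A B C, x = G ^+ 2 * A + p%:R * G * B + p%:R ^+ 2 * C.

Lemma inIP x : reflect (exists u v, x = G * u + p%:R * v) (inI x).
Proof.
apply: (iffP idP) => [/dvdpP[q e]|[u [v ->]]].
  have [u eu] := redp_surj q.
  have [|v ->] := @redp_eqP x (G * u); first by rewrite rmorphM /= eu e mulrC.
  by exists u, v.
rewrite /inI rmorphD !rmorphM /= rmorph_nat -polyC_natr pchar_Fp_0 // mul0r addr0.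
exact: dvdp_mulr.
Qed.

Lemma inID x y : inI x -> inI y -> inI (x + y).
Proof. by rewrite /inI rmorphD; apply: dvdp_add. Qed.
Lemma inIN x : inI (- x) = inI x.
Proof. by rewrite /inI rmorphN dvdpNr. Qed.
Lemma inIB x y : inI x -> inI y -> inI (x - y).
Proof. by move=> ? ?; apply: inID; rewrite ?inIN. Qed.
Lemma inIMl x y : inI y -> inI (x * y).
Proof. by rewrite /inI rmorphM; apply: dvdp_mull. Qed.
Lemma inIMr x y : inI x -> inI (x * y).
Proof. by rewrite mulrC; apply: inIMl. Qed.
Lemma inIDr x y : inI x -> inI (x + y) = inI y.
Proof.
move=> hx; apply/idP/idP => [h|]; last exact: inID.
by rewrite -[y](addKr x) addrC; apply: inIB.
Qed.
Lemma inIp x : inI (p%:R * x).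
Proof. by apply/inIP; exists 0, x; rewrite mulr0 add0r. Qed.
Lemma inIG : inI G. Proof. exact: dvdpp. Qed.

Lemma irred_dvdM (F : fieldType) (g x y : {poly F}) :
  irreducible_poly g -> (g %| x * y) = (g %| x) || (g %| y).
Proof.
move=> ig; have [h|h] := boolP (coprimep g x).
  rewrite Gauss_dvdpr //; case: (boolP (g %| x)) => // gx.
  have [sg _] := ig; have := coprimep_dvdl gx h.
  by rewrite coprimepp => /eqP e; rewrite e in sg.
have gx : g %| x.
  have [_ H] := ig; have /eqp_dvdl<- := H _ h (dvdp_gcdl _ _).
  exact: dvdp_gcdr.
by rewrite gx dvdp_mulr.
Qed.

Lemma inIM x y : inI (x * y) = inI x || inI y.
Proof. by rewrite /inI rmorphM irred_dvdM. Qed.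

Lemma inI1 : inI 1 = false.
Proof.
rewrite /inI rmorph1 dvdp1; have [sg _] := irG.
by apply/negP => /eqP e; rewrite e in sg.
Qed.

Lemma inIX x n : inI (x ^+ n) -> inI x.
Proof. by elim: n => [|n IH]; rewrite ?inI1 // exprS inIM => /orP[]. Qed.

Lemma inIC (k : int) : inI k%:P = (p %| k)%Z.
Proof.
rewrite /inI map_polyC /= -intr_Fp_eq0.
have [->|k0] := eqVneq (k%:~R : 'F_p) 0; first by rewrite polyC0 dvdp0.
apply/negP => /dvdp_leq; rewrite polyC_eq0 size_polyC k0 => /(_ isT).
by rewrite leqNgt; have [-> _] := irG.
Qed.

Lemma inI2D x y : inI2 x -> inI2 y -> inI2 (x + y).
Proof.
move=> [A [B [C ->]]] [A' [B' [C' ->]]].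
by exists (A + A'), (B + B'), (C + C'); ring.
Qed.
Lemma inI2Ml x y : inI2 y -> inI2 (x * y).
Proof. by move=> [A [B [C ->]]]; exists (x * A), (x * B), (x * C); ring. Qed.
Lemma inI2Mr x y : inI2 x -> inI2 (x * y).
Proof. by rewrite mulrC; apply: inI2Ml. Qed.
Lemma inI2N x : inI2 x -> inI2 (- x).
Proof. by move=> h; rewrite -mulN1r; apply: inI2Ml. Qed.
Lemma inI2B x y : inI2 x -> inI2 y -> inI2 (x - y).
Proof. by move=> ? ?; apply/inI2D/inI2N. Qed.
Lemma inI2M x y : inI x -> inI y -> inI2 (x * y).
Proof.
move=> /inIP[u [v ->]] /inIP[u' [v' ->]].
by exists (u * u'), (u * v' + v * u'), (v * v'); ring.
Qed.
Lemma inI2X x n : inI x -> (2 <= n)%N -> inI2 (x ^+ n).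
Proof.
move=> hx; case: n => [//|[//|n]] _.
by rewrite !exprS mulrA; apply/inI2Mr/inI2M.
Qed.
Lemma inI2W x : inI2 x -> inI x.
Proof.
move=> [A [B [C ->]]]; apply/inIP; exists (G * A), (G * B + p%:R * C); ring.
Qed.
Lemma inI2p x : inI x -> inI2 (p%:R * x).
Proof. by apply: inI2M; rewrite -[p%:R]mulr1 inIp. Qed.

(** By the Leibniz rule: a derivation maps the square of any ideal into the
    ideal. *)
Lemma inI2_deriv x : inI2 x -> inI x^`().
Proof.
move=> [A [B [C ->]]].
have -> : G ^+ 2 * A + p%:R * G * B + p%:R ^+ 2 * C =
          G * (G * A) + p%:R * (G * B + p%:R * C) by ring.
rewrite mulr_natl derivD derivMn -[X in _ + X]mulr_natl; apply: inID; last exact: inIp.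
by rewrite derivM; apply: inID; [apply/inIMl/inIMr | apply/inIMr]; exact: inIG.
Qed.

(** If p x = G^2 A + p G B + p^2 C, then [G^2 A] vanishes modulo p, hence so does
    [A], and the equation can be divided by p. *)
Lemma inI2_pdiv x : inI2 (p%:R * x) -> inI x.
Proof.
move=> [A [B [C e]]].
have p0 : (p%:R : {poly int}) != 0.
  by rewrite -polyC_natr polyC_eq0 natz; case: (p) pr.
have : redp p G ^+ 2 * redp p A == 0.
  rewrite -rmorphXn -rmorphM /=; apply/redp_eq0P.
  exists (x - G * B - p%:R * C); rewrite !mulrBr e; ring.
have G0 : redp p G != 0 by have [+ _] := irG; case: eqP => // ->; rewrite size_poly0.
rewrite mulf_eq0 expf_eq0 /= (negPf G0) /= => /redp_eq0P[A' eA].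
apply/inIP; exists (G * A' + B), C; apply: (mulfI p0); rewrite e eA; ring.
Qed.

Lemma inI2C (k : int) : inI2 k%:P -> ((p ^ 2)%N %| k)%Z.
Proof.
move=> h; have := inI2W h; rewrite inIC => /dvdzP[k' ek]; move: h.
have -> : k%:P = p%:R * k'%:P :> {poly int}.
  by rewrite ek [k' * _]mulrC rmorphM /= -[Posz p]natz polyC_natr.
move=> /inI2_pdiv; rewrite inIC ek => /dvdzP[k'' ->].
by apply/dvdzP; exists k''; rewrite PoszM mulrA.
Qed.

End Reduction.

(** For monic irreducible [T], this says that the ring [Z[x]/(T)] is regular at
    its maximal ideals above p, equivalently that p does not divide its index in
    the ring of integers. *)
Definition regular_at (p : nat) (T : {poly int}) :=
  forall G : {poly int}, irreducible_poly (redp p G) -> ~ inI2 p G T.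

(** * Dedekind's criterion *)

Lemma irreducible_factor (F : fieldType) (e : {poly F}) :
  (1 < size e)%N -> exists2 g, irreducible_poly g & g %| e.
Proof.
have [n] := ubnP (size e); elim: n e => // n IH e /ltnSE le_n lt1.
have [?|/not_andP[]] := pselect (irreducible_poly e); first by exists e.
  by rewrite lt1.
move=> /existsNP[q /not_implyP[q1 /not_implyP[qe nqe]]].
have e0 : e != 0 by rewrite -size_poly_gt0 (ltn_trans _ lt1).
have q0 : q != 0 := dvdpN0 qe e0.
have lt1q : (1 < size q)%N by rewrite ltn_neqAle eq_sym q1 size_poly_gt0.
have ltqe : (size q < size e)%N.
  by rewrite ltn_neqAle (dvdp_leq e0 qe) andbT dvdp_size_eqp //; apply/negP.
have [|//|g ig gq] := IH q; first exact: leq_trans ltqe le_n.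
by exists g => //; apply: dvdp_trans gq qe.
Qed.

Definition zev (K : fieldType) (x : K) : {poly int} -> K :=
  horner_eval x \o map_poly intr.

HB.instance Definition _ (K : fieldType) (x : K) :=
  GRing.RMorphism.on (zev x).

Lemma zevE (K : fieldType) (x : K) h : zev x h = (map_poly intr h).[x].
Proof. by []. Qed.

Lemma zevC (K : fieldType) (x : K) c : zev x c%:P = c%:~R.
Proof. by rewrite zevE map_polyC hornerC. Qed.

Lemma zevX (K : fieldType) (x : K) : zev x 'X = x.
Proof. by rewrite zevE map_polyX hornerX. Qed.

(** The quotient [A] has integer coefficients, so that relations between values at
    [tau] become congruences modulo [T] in Z[x], which can be reduced modulo p. *)
Definition is_zminpoly (K : fieldType) (tau : K) (T : {poly int}) :=
  zev tau T = 0 /\ forall Y, zev tau Y = 0 -> exists A, Y = T * A.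

Section Dedekind.
Variables (K : fieldType) (tau : K) (T : {poly int}).
Hypothesis minT : is_zminpoly tau T.

Local Notation integral := (integralOver (intr : int -> K)).

Lemma integral_zev h : integral tau -> integral (zev tau h).
Proof.
move=> it; rewrite zevE; apply: integral_horner => //.
by apply/integral_poly => i; rewrite coef_map; apply: integral_id.
Qed.

(** If [mu] has degree k, then [b^k mu(a / b)] is a polynomial that vanishes at
    [tau], so that [T] divides it; its only term without a factor [b] is [a^k].
    Every prime ideal that contains [T] and [b] therefore contains [a]. *)
Lemma homogenized_equation (mu a b : {poly int}) (gamma : K) :
  mu \is monic -> root (map_poly intr mu) gamma ->
  zev tau a = gamma * zev tau b ->
  exists k A B, a ^+ k = T * A + b * B.
Proof.
move=> mon_mu /rootP mu0 e; pose k := (size mu).-1.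
have sk : size mu = k.+1 by rewrite prednK // size_poly_gt0 monic_neq0.
pose Y := \sum_(i < k.+1) (mu`_i)%:P * a ^+ i * b ^+ (k - i).
have [A eA] : exists A, Y = T * A.
  apply: minT.2; transitivity (zev tau b ^+ k * (map_poly intr mu).[gamma]).
    rewrite (@horner_coef_wide _ k.+1); last by rewrite -sk size_poly.
    rewrite rmorph_sum mulr_sumr; apply: eq_bigr => i _.
    rewrite !rmorphM !rmorphXn /= zevC e coef_map exprMn.
    have lik : (i <= k)%N by rewrite -ltnS.
    have -> : zev tau b ^+ k = zev tau b ^+ (k - i) * zev tau b ^+ i.
      by rewrite -exprD subnK.
    rewrite /=; ring.
  by rewrite mu0 mulr0.
exists k, A, (- \sum_(i < k) (mu`_i)%:P * a ^+ i * b ^+ (k - i).-1).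
have := eA; rewrite /Y big_ord_recr /= subnn expr0 mulr1.
have -> : mu`_k = 1 by apply/eqP; have := mon_mu; rewrite monicE lead_coefE sk.
rewrite mul1r => <-; rewrite mulrN mulr_sumr addrAC -[LHS]add0r; congr (_ + _).
apply/esym/eqP; rewrite subr_eq0; apply/eqP/eq_bigr => i _.
by rewrite mulrCA -exprS prednK // subn_gt0.
Qed.

(** If [T] divides [h] modulo p, then [h] can be replaced by a multiple of p.
    Otherwise some [G] irreducible modulo p divides the cofactor of [gcd (h, T)]
    in [T]: [T = G q + p r], where [q] is a multiple of the gcd.  By the Bezout
    relation for the gcd, [gamma = q(tau) / p] is of the form [S(tau) y + v(tau)],
    hence integral, and [gamma = - r(tau) / G(tau)].  Clearing denominators in an
    integral equation of [gamma] for each of these two fractions shows that [q]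
    and [r] lie in [(p, G)], so that [T] lies in its square. *)
Lemma regular_divide p h y : prime p -> (p%:R : K) != 0 -> T \is monic ->
  regular_at p T -> integral tau -> integral y -> p%:R * y = zev tau h ->
  exists h', y = zev tau h'.
Proof.
move=> pr pK monT reg it iy e.
have [/dvdpP[u eu]|nd] := boolP (redp p T %| redp p h).
  have [w ew] := redp_surj u.
  have [|h' eh] := @redp_eqP p pr h (w * T); first by rewrite rmorphM /= ew.
  exists h'; apply: (mulfI pK); rewrite e eh rmorphD !rmorphM /= minT.1 mulr0 add0r.
  by rewrite rmorph_nat.
have monTp : redp p T \is monic by apply: monic_map.
have [[s t] /= Bez] := Bezoutp (redp p h) (redp p T).
set d := gcdp _ _ in Bez.
have /dvdpP[e0 Te] : d %| redp p T by apply: dvdp_gcdr.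
have Tp0 := monic_neq0 monTp.
have e00 : e0 != 0 by apply: contraNneq Tp0 => e00; rewrite Te e00 mul0r.
have [|g ig /dvdpP[e1 ee]] := @irreducible_factor _ e0.
  rewrite ltn_neqAle size_poly_gt0 e00 andbT eq_sym; apply: contra nd => se.
  have /eqp_dvdl-> : redp p T %= d.
    by rewrite Te -{2}[d]mul1r; apply: eqp_mulr; rewrite -size_poly_eq1.
  exact: dvdp_gcdl.
have [G eG] := redp_surj g.
have /eqpP[[c1 c2] /= /andP[c10 c20] Bez'] := Bez.
have [q eq_] := redp_surj (e1 * d).
have [r Tr] : exists r, T = G * q + p%:R * r.
  apply: redp_eqP => //; rewrite rmorphM /= eG eq_ Te ee; ring.
have irG : irreducible_poly (redp p G) by rewrite eG.
case: (reg G irG).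
have [S eS] := redp_surj (e1 * ((c1 / c2) *: s)).
have [S' eS'] := redp_surj (e1 * ((c1 / c2) *: t)).
have [v ev] : exists v, q = (S * h + S' * T) + p%:R * v.
  apply: redp_eqP => //; rewrite rmorphD !rmorphM /= eS eS' eq_.
  rewrite -!mulrA -mulrDr -!scalerAl -scalerDr; congr (_ * _).
  by rewrite mulrC -scalerA Bez' scalerA mulVf // scale1r.
pose gamma := zev tau S * y + zev tau v.
have qg : zev tau q = gamma * p%:R.
  rewrite ev !rmorphD !rmorphM /= minT.1 mulr0 addr0 -e rmorph_nat /gamma; ring.
have ig' : integral gamma.
  by apply: integral_add; [apply: integral_mul|]; try apply: integral_zev.
have [mu mon_mu mu0] := ig'.
have rG : zev tau (- r) = gamma * zev tau G.
  apply: (mulfI pK); have := minT.1; rewrite Tr rmorphD !rmorphM /= qg rmorph_nat.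
  by move/eqP; rewrite addrC addr_eq0 rmorphN mulrN => /eqP->; ring.
have PT : inI p G T by rewrite Tr; apply: inID; [apply/inIMr/inIG | apply: inIp].
have [] := homogenized_equation mon_mu mu0 rG.
move=> k [A [B rk]].
have Pr : inI p G r.
  rewrite -inIN; apply: (@inIX _ _ irG _ k); rewrite rk.
  by apply: inID; apply: inIMr => //; apply: inIG.
have [|k' [A' [B' qk]]] := homogenized_equation (a := q) (b := p%:R) mon_mu mu0.
  by rewrite rmorph_nat.
have Pq : inI p G q.
  by apply: (@inIX _ _ irG _ k'); rewrite qk; apply: inID; [apply: inIMr | apply: inIp].
rewrite Tr; apply: inI2D; last by apply: inI2p.
by apply: inI2M => //; apply: inIG.
Qed.

(** The prime factors of the denominator [M] at which [T] is regular are divided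
    out one at a time. *)
Lemma integral_denominator (iota : {rmorphism rat -> K}) M h y : T \is monic ->
  integral tau -> integral y -> (0 < M)%N -> M%:R * y = zev tau h ->
  exists N h', [/\ (0 < N)%N, N%:R * y = zev tau h' &
    forall p, prime p -> regular_at p T -> ~~ (p %| N)%N].
Proof.
move=> monT it iy; elim/ltn_ind: M h => M IH h M0 e.
have [[p [pr reg /dvdnP[M1 eM]]]|nex] :=
  pselect (exists p, [/\ prime p, regular_at p T & (p %| M)%N]); last first.
  exists M, h; split=> // p pr reg; apply/negP => dv.
  by apply: nex; exists p.
have M10 : (0 < M1)%N by move: M0; rewrite eM muln_gt0 => /andP[].
have pK : (p%:R : K) != 0 by rewrite -(rmorph_nat iota) fmorph_eq0 pnatr_eq0 -lt0n prime_gt0.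
have [||h' e'] := @regular_divide p h (M1%:R * y) pr pK monT reg it.
- by apply: integral_mul => //; apply: integral_nat.
- by rewrite -e eM natrM; ring.
- by apply: (IH M1 _ h') => //; rewrite eM ltn_Pmulr // prime_gt1.
Qed.

End Dedekind.

(** The remainder of [Y] by the monic polynomial [T] is an integer polynomial that
    [T] divides over Q, hence 0 for reasons of degree. *)
Lemma irreducible_zminpoly (K : fieldType) (iota : {rmorphism rat -> K})
    (tau : K) (T : {poly int}) :
  T \is monic -> irreducible_poly (map_poly intr T : {poly rat}) ->
  zev tau T = 0 -> is_zminpoly tau T.
Proof.
move=> monT irT T0; split=> // Y Y0.
have zevQ X : zev tau X = (map_poly iota (map_poly intr X)).[tau].
  by rewrite zevE -map_poly_comp; congr (_.[_]); apply: eq_map_poly => x /=; rewrite rmorph_int.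
have rootQ X : zev tau X = 0 -> root (map_poly iota (map_poly intr X)) tau.
  by move=> X0; apply/rootP; rewrite -zevQ.
have [/(Bezout_coprimepP _ _)[[u v] /= uv]|ncop] :=
  boolP (coprimep (map_poly intr T : {poly rat}) (map_poly intr Y)).
  have : root (map_poly iota 1) tau.
    have := uv; rewrite -(eqp_map iota) => /eqp_root<-; rewrite rmorphD !rmorphM /= rootE hornerD !hornerM.
    by rewrite -!zevQ T0 Y0 !mulr0 addr0.
  by rewrite rmorph1 (negPf (root1 _)).
have : (map_poly intr T : {poly rat}) %| map_poly intr Y.
  have [_ H] := irT; have /eqp_dvdl<- := H _ ncop (dvdp_gcdl _ _).
  exact: dvdp_gcdr.
pose B := Pdiv.CommonRing.rmodp Y T; pose A := Pdiv.CommonRing.rdivp Y T.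
have eY : Y = A * T + B := Pdiv.RingMonic.rdivp_eq monT Y.
rewrite eY rmorphD rmorphM /= dvdp_addr ?dvdp_mull // => dv.
exists A; rewrite mulrC; suff -> : B = 0 by rewrite addr0.
have szQ X : size (map_poly intr X : {poly rat}) = size X.
  by rewrite size_map_inj_poly //; apply: intr_inj.
apply/eqP; rewrite -size_poly_eq0 -szQ size_poly_eq0; apply: contraTT dv => B0.
apply/negP => /(dvdp_leq B0); rewrite !szQ leqNgt.
by rewrite Pdiv.CommonRing.ltn_rmodpN0 // monic_neq0.
Qed.

(** * The polynomial F and its derivative modulo (p, G) *)

Lemma sqr_eq_4 (a d : int) : a ^+ 2 = 4 * d -> exists e, a = 2 * e /\ d = e ^+ 2.
Proof.
move=> e; exists (a %/ 2)%Z.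
have d2 : (2 %| a)%Z.
  have: (2 %| a ^+ 2)%Z by rewrite e; apply/dvdzP; exists (2 * d); ring.
  by rewrite !dvdzE abszX Euclid_dvdX // => /andP[].
have ea : a = 2 * (a %/ 2)%Z by rewrite mulrC divzK.
split=> //; apply: (@mulfI _ 4) => //; rewrite -e {1}ea; ring.
Qed.

Definition f_at (e b : int) n (w : {poly int}) : {poly int} :=
  w ^+ (n - 2) * (w + e%:P) ^+ 2 + b%:P.

Lemma aux_polyE (e b c : int) n k : (2 <= n)%N ->
  aux_poly (2 * e) b c (e ^+ 2) n k = f_at e b n ('X^k + c%:P).
Proof.
case: n => [|[|n]] // _; rewrite /aux_poly /f_at !subSS subn0 /=.
rewrite -!mul_polyC !exprS !rmorphM /=; set w := 'X^k + _.
have -> : (2%:P : {poly int}) = 2 by rewrite (rmorph_nat _ 2).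
ring.
Qed.

Lemma f_polyE (e b c : int) n : (2 <= n)%N ->
  (f_poly (2 * e) b (e ^+ 2) n).[c] = c ^+ (n - 2) * (c + e) ^+ 2 + b.
Proof.
case: n => [|[|n]] // _; rewrite /f_poly !subSS subn0 /=.
rewrite [LHS](_ : _ = c ^+ n.+2 + 2 * e * c ^+ n.+1 + e ^+ 2 * c ^+ n + b).
  by rewrite !exprS; ring.
by rewrite !(hornerD, hornerZ, hornerXn, hornerC).
Qed.

Lemma f_atC e b c n :
  f_at e b n c%:P = (c ^+ (n - 2) * (c + e) ^+ 2 + b)%:P.
Proof. by rewrite /f_at !(rmorphD, rmorphM, rmorphXn). Qed.

Lemma deriv_f_at e b n w : 
  (f_at e b n.+3 w)^`() =
  w ^+ n * (w + e%:P) * (n.+3%:R * w + n.+1%:R * e%:P) * w^`().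
Proof.
have dE (x : {poly int}) k : (x ^+ k.+1)^`() = k.+1%:R * x ^+ k * x^`().
  by rewrite deriv_exp /= -[LHS]mulr_natl; ring.
rewrite /f_at !subSS subn0 derivD derivC addr0 derivM !dE derivD derivC addr0.
have -> : n.+3%:R = 2 + n.+1%:R :> {poly int} by rewrite -natrD.
rewrite !exprS; ring.
Qed.

Lemma exprD_mod_sqr (R : comNzRingType) (x y : R) k :
  exists z, (x + y) ^+ k.+1 = y ^+ k.+1 + k.+1%:R * y ^+ k * x + x ^+ 2 * z.
Proof.
elim: k => [|k [z IH]]; first by exists 0; rewrite expr0; ring.
exists (x * z + y * z + k.+1%:R * y ^+ k); rewrite exprS IH !exprS.
rewrite -[k.+2%:R]natr1; ring.
Qed.

Lemma exprB_dvd (R : comNzRingType) (x y : R) k :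
  exists z, x ^+ k - y ^+ k = (x - y) * z.
Proof. by eexists; apply: subrXX. Qed.

Section Cases.
Variables (p : nat) (pr : prime p) (G : {poly int}).
Hypothesis irG : irreducible_poly (redp p G).
Local Notation inI := (inI p G).
Local Notation inI2 := (inI2 p G).

Lemma inIB_exp x y k : inI (x - y) -> inI (x ^+ k - y ^+ k).
Proof. by have [z ->] := exprB_dvd x y k; apply: inIMr. Qed.

Lemma inI2B_exp x y k : inI2 (x - y) -> inI2 (x ^+ k - y ^+ k).
Proof. by have [z ->] := exprB_dvd x y k; apply: inI2Mr. Qed.

Lemma inIC_dvd (k : int) : (p %| k)%Z -> inI k%:P.
Proof. by rewrite inIC. Qed.

(** The terms of degree at least 2 in [x] are in the square, and the linear one
    has the coefficient q. *)
Lemma inI2_expD x y q : inI x -> (p %| q)%N -> inI2 ((x + y) ^+ q - y ^+ q).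
Proof.
case: q => [|q] hx dq; first by rewrite !expr0 subrr; exists 0, 0, 0; rewrite !mulr0 !addr0.
have [z ->] := exprD_mod_sqr x y q; rewrite -[_ + _ + x ^+ 2 * z]addrA [y ^+ _ + _]addrC addrK.
have /dvdnP[q' ->] := dq.
apply: inI2D; last by apply/inI2Mr/inI2X.
rewrite natrM -!mulrA mulrCA; apply: inI2p => //.
by do 2!apply: inIMl.
Qed.

Lemma inI2_sqr_dvd (k : int) : (p %| k)%Z -> inI2 (k ^+ 2)%:P.
Proof. by move=> dk; rewrite rmorphXn; apply: inI2X => //; apply: inIC_dvd. Qed.

Variables (e b c : int) (m n : nat).
Let w : {poly int} := 'X^m + c%:P.
Let F := f_at e b n w.

Lemma f_at_cong (x y : {poly int}) : inI2 (x - y) ->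
  inI2 (f_at e b n x - f_at e b n y).
Proof.
move=> h; rewrite /f_at opprD addrACA subrr addr0.
set a1 := x ^+ _; set b1 := y ^+ _.
have -> : a1 * (x + e%:P) ^+ 2 - b1 * (y + e%:P) ^+ 2 =
  (a1 - b1) * (x + e%:P) ^+ 2 + b1 * ((x - y) * (x + y + 2 * e%:P)) by ring.
apply: inI2D; first exact/inI2Mr/inI2B_exp.
exact/inI2Ml/inI2Mr.
Qed.

(** If the ideal contains ['X], then [w = 'X^m + c] is c modulo its square, and
    [F] is congruent to [f(c)]. *)
Lemma inI_root_X : (2 <= m)%N -> inI 'X -> inI2 F ->
  ((p ^ 2)%N %| c ^+ (n - 2) * (c + e) ^+ 2 + b)%Z.
Proof.
move=> m2 hX hF; apply: (inI2C pr irG); rewrite -f_atC.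
rewrite -[f_at _ _ _ _](subKr F); apply: inI2B => //.
by apply: f_at_cong; rewrite /w addrK; apply: inI2X.
Qed.

Lemma f_at_we x : inI (x + e%:P) -> inI2 (f_at e b n x) -> ((p ^ 2)%N %| b)%Z.
Proof.
move=> hx hF; apply: (inI2C pr irG).
have -> : b%:P = f_at e b n x - x ^+ (n - 2) * (x + e%:P) ^+ 2 by rewrite /f_at; ring.
by apply: inI2B => //; apply/inI2Ml/inI2X.
Qed.

(** Modulo p, [F] is [w^(n-2) (w + e)^2], so that [w] or [w + e] is in the ideal;
    if that factor has an exponent at least 2, then b is in the square.  The factor
    [w] is simple for n = 3 only, and it is congruent to [w + e] if p divides e. *)
Lemma regular_i : (2 <= n)%N -> (3 < n)%N || (p %| e)%Z ->
  (p %| b)%Z -> ~~ ((p ^ 2)%N %| b)%Z -> ~ inI2 F.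
Proof.
move=> n2 ne pb /negP p2b hF; apply: p2b.
have : inI (w ^+ (n - 2) * (w + e%:P) ^+ 2).
  have := inI2W pr hF; rewrite /F /f_at addrC inIDr //.
  exact: inIC_dvd.
rewrite inIM // => /orP[/(inIX irG) hw|/(inIX irG) hw]; last by exact: f_at_we hF.
case/orP: ne => ne; last first.
  by apply: (f_at_we _ hF); apply: inID => //; apply: inIC_dvd.
apply: (inI2C pr irG).
have -> : b%:P = F - w ^+ (n - 2) * (w + e%:P) ^+ 2 by rewrite /F /f_at; ring.
by apply: inI2B => //; apply/inI2Mr/inI2X => //; rewrite leq_subRL.
Qed.

(** [F' = w^(n-3) (w + e) (n w + (n-2) e) m 'X^(m-1)], where [w] and [w + e] are
    units modulo the ideal because [F] is in it and b is not. *)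
Lemma inI_deriv_f_at : (3 <= n)%N -> ~~ (p %| b)%Z -> ~~ (p %| m)%N -> inI2 F ->
  inI (n%:R * w + (n - 2)%:R * e%:P) \/ inI 'X.
Proof.
case: n @F => [|[|[|k]]] // F' _ pb pm hF.
have := inI2_deriv pr hF; rewrite /F' deriv_f_at.
have Pb x : inI x -> inI (b%:P + x) = false.
  by move=> hx; rewrite addrC inIDr // inIC //; apply: negPf.
rewrite !inIM // => /orP[/orP[/orP[/(inIX irG) h|h]|h]|].
- have := inI2W pr hF; rewrite /F' /f_at addrC Pb //.
  by rewrite !subSS subn0 exprS -mulrA; exact: inIMr.
- have := inI2W pr hF; rewrite /F' /f_at addrC Pb //.
  by apply: inIMl; rewrite exprS; apply: inIMr.
- by left; rewrite !subSS subn0.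
rewrite /w derivD derivC addr0 derivXn -mulr_natl inIM // -polyC_natr inIC // natz.
by rewrite dvdzE /= (negPf pm) => /(inIX irG) h; right.
Qed.

End Cases.

(** * Regularity at primes that do not divide m or the discriminant *)

Lemma dvdzM_prime p (x y : int) : prime p -> (p %| x * y)%Z = (p %| x)%Z || (p %| y)%Z.
Proof. by move=> pr; rewrite !dvdzE abszM /= Euclid_dvdM. Qed.

Lemma dvdzX_prime p (x : int) k : prime p -> (p %| x ^+ k)%Z -> (p %| x)%Z.
Proof. by move=> pr; rewrite !dvdzE abszX /= Euclid_dvdX // => /andP[]. Qed.

Lemma dvdz_psqr p (x : int) : ((p ^ 2)%N %| x)%Z -> (p %| x)%Z.
Proof. by rewrite !dvdzE /=; apply/dvdn_trans/dvdn_exp. Qed.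

(** Up to sign, the integer of condition (v) is n^n times the critical value of f
    at [w = - (n-2) e / n]. *)
Lemma critical_value_sign (e b : int) n : (2 <= n)%N ->
  (- n%:Z) ^+ n * b + 4 * (n%:Z - 2) ^+ (n - 2) * e ^+ n =
  (-1) ^+ n * (n%:R ^+ n * b + 4 * e ^+ 2 * (- ((n - 2)%:R * e)) ^+ (n - 2)).
Proof.
move=> n2; rewrite (exprNn n%:Z) (exprNn (_ * e)) exprMn natrB // !natz.
have -> : (-1) ^+ n = (-1) ^+ (n - 2) :> int.
  by rewrite -[in LHS](subnK n2) exprD sqrrN expr1n mulr1.
have -> : e ^+ n = e ^+ (n - 2) * e ^+ 2 by rewrite -exprD subnK.
have := sqrr_sign int (n - 2); set sg := (-1) ^+ (n - 2) => sg1.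
set x := (_ - 2%:Z) ^+ _; set y := e ^+ (n - 2).
transitivity (sg * n%:Z ^+ n * b + sg ^+ 2 * (4 * x * (y * e ^+ 2))); last by ring.
by rewrite sg1 mul1r.
Qed.

(** One of c and c + e is even. *)
Lemma even_mul_add_odd (c e : int) k : ~~ (2 %| e)%Z ->
  (2 %| c ^+ k.+1 * (c + e) ^+ 2)%Z.
Proof.
move=> ne; have : (2 %| c)%Z || (2 %| c + e)%Z by lia.
rewrite exprS expr2 => /orP[] h; first by rewrite -mulrA dvdz_mulr.
by rewrite dvdz_mull // dvdz_mulr.
Qed.

Section Frobenius.
Variables (p : nat) (pr : prime p) (k : nat).

Lemma pnat_pchar_Fp : [pchar {poly 'F_p}]%R.-nat (p ^ k)%N.
Proof.
rewrite pnatX pnatE // (rmorph_pchar (polyC : {rmorphism 'F_p -> {poly 'F_p}})) //.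
exact: pchar_Fp.
Qed.

Lemma redp_expD (x y : {poly int}) :
  redp p ((x + y) ^+ (p ^ k)) = redp p x ^+ (p ^ k) + redp p y ^+ (p ^ k).
Proof. by rewrite rmorphXn rmorphD /= exprDn_pchar // pnat_pchar_Fp. Qed.

Lemma Fp_expX (x : 'F_p) : x ^+ (p ^ k) = x.
Proof.
elim: k => [|i IH]; first by rewrite expn0 expr1.
by rewrite expnSr exprM IH -[X in _ ^+ X](card_Fp pr) expf_card.
Qed.

Lemma redpC_exp (x : int) : redp p x%:P ^+ (p ^ k) = redp p x%:P.
Proof. by rewrite map_polyC /= -rmorphXn /= Fp_expX. Qed.
End Frobenius.

Lemma discriminant_bezout (T : {poly int}) : T \is monic -> (2 < size T)%N ->
  exists u v, (discriminant T)%:P = u * T + v * T^`().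
Proof.
move=> monT sT; rewrite /discriminant (monicP monT) divz1.
have sT' : (1 < size T^`())%N.
  rewrite ltnNge; apply/negP => /leq_sizeP/(_ (size T).-2) h.
  have /h : (1 <= (size T).-2)%N by lia.
  rewrite coef_deriv; have -> : (size T).-2.+1 = (size T).-1 by lia.
  by rewrite -lead_coefE (monicP monT) => /eqP; rewrite pnatr_eq0; lia.
have [||[u v] /= _ e] := @resultant_in_ideal _ T T^`(); rewrite ?(ltnW sT) //.
set sg := (-1) ^+ _; exists (sg%:P * u), (sg%:P * v).
by rewrite rmorphM /= e mulrDr !mulrA.
Qed.

(** Away from the discriminant, a Bezout relation between [T] and [T'] over Z
    shows that [T] has no multiple factor modulo [p]. *)
Lemma regular_ndisc p (T : {poly int}) : prime p -> T \is monic ->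
  (2 < size T)%N -> ~~ (p %| discriminant T)%Z -> regular_at p T.
Proof.
move=> pr monT sT /negP nd G irG hT; apply: nd.
have [u [v e]] := discriminant_bezout monT sT.
rewrite -(inIC pr irG) e; apply: inID; apply: inIMl; last exact: inI2_deriv.
exact: inI2W hT.
Qed.

Section Cases.
Variables (p : nat) (pr : prime p) (G : {poly int}).
Hypothesis irG : irreducible_poly (redp p G).
Local Notation inI := (inI p G).
Local Notation inI2 := (inI2 p G).
Variables (e b c : int) (m n : nat).
Hypotheses (n3 : (3 <= n)%N) (m2 : (2 <= m)%N).
Let n2 : (2 <= n)%N := ltnW n3.
Let a := 2 * e.
Let d := e ^+ 2.
Let F := aux_poly a b c d n m.
Let w : {poly int} := 'X^m + c%:P.

Let FE : F = f_at e b n w.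
Proof. exact: aux_polyE. Qed.

Let notb : ~~ (p %| b)%Z -> inI2 F -> ~~ inI w && ~~ inI (w + e%:P).
Proof.
rewrite FE => pb hF; rewrite -negb_or; apply: contra pb => h.
have := inI2W pr hF; rewrite /f_at inIDr ?inIC //.
have [k ->] : exists k, n = k.+3 by exists (n - 3)%N; lia.
case/orP: h => h; first by rewrite !subSS subn0 exprS -mulrA; apply: inIMr.
by apply: inIMl; rewrite exprS; apply: inIMr.
Qed.

(** Put [x = n w + (n-2) e].  By [inI_deriv_f_at], the ideal contains ['X] or
    [x].  In the first case [F] is congruent to [f(c)] modulo the square.  In the
    second, as f' vanishes where x does, [n^n F] is a polynomial in [x] without
    linear term, so that its constant term, n^n times the critical value of f, is
    in the square. *)
Lemma regular_v : cond_v a b c d n m p -> ~ inI2 F.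
Proof.
have [k ek] : exists k, n = k.+3 by exists (n - 3)%N; lia.
move=> [pabm pf pE] hF; move: pabm.
rewrite !dvdzM_prime // !negb_or => /andP[/andP[/andP[p2 pe] pb] pm].
move: pf; rewrite f_polyE // => /negP; apply.
have := hF; rewrite FE => hF'.
have [u|hX] := inI_deriv_f_at pr irG n3 pb pm hF'; last exact: inI_root_X hF'.
case/negP: pE; set E := (X in (_ %| X)%Z).
pose x : {poly int} := n%:R * w + (n - 2)%:R * e%:P.
(* Taylor expansion of (n w)^(n-2) at x = 0. *)
have [z1 ez1] := exprD_mod_sqr x (- ((n - 2)%:R * e%:P)) k.
rewrite /E /a [2 * e]mulrC mulzK // critical_value_sign // {E}.
apply: dvdz_mull; apply: (inI2C pr irG).
have e2 : (n - 2)%N = k.+1 by rewrite ek !subSS subn0.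
rewrite -e2 in ez1.
have et (y : {poly int}) : y ^+ (n - 2) = y * y ^+ k by rewrite e2 exprS.
have eF : n%:R ^+ n * F = (x + - ((n - 2)%:R * e%:P)) ^+ (n - 2) * (x + 2 * e%:P) ^+ 2
    + n%:R ^+ n * b%:P.
  rewrite FE /f_at mulrDr; congr (_ + _).
  have -> : x + - ((n - 2)%:R * e%:P) = n%:R * w by rewrite /x addrK.
  have -> : x + 2 * e%:P = n%:R * (w + e%:P).
    by rewrite /x natrB //; ring.
  have -> : n%:R ^+ n = n%:R ^+ (n - 2) * n%:R ^+ 2 :> {poly int} by rewrite -exprD subnK.
  by rewrite !exprMn; ring.
have hx2 : inI2 (x ^+ 2) by apply: inI2X.
set t := (- ((n - 2)%:R * e%:P)) ^+ k : {poly int} in ez1.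
pose le : {poly int} := (n - 2)%:R * e%:P.
pose r := - le * t + 4 * le * t + (n - 2)%:R * t * x + z1 * (x + 2 * e%:P) ^+ 2.
have -> : (n%:R ^+ n * b + 4 * e ^+ 2 * (- ((n - 2)%:R * e)) ^+ (n - 2))%:P =
    n%:R ^+ n * F - x ^+ 2 * r.
  rewrite eF ez1 !(rmorphD, rmorphM, rmorphXn, rmorphN, rmorph_nat) /= !et -/t -/le.
  rewrite /r !rmorph1 /le; ring.
by apply: inI2B; [apply: inI2Ml | apply: inI2Mr].
Qed.

(** For odd n, [n w + (n-2) e] is congruent to [w + e] modulo 2, which is a unit,
    so that ['X] is in the ideal and [f(c)] is divisible by 4; but
    [c^(n-2) (c + e)^2] is even, and b is odd.  For even n, [F = A^2 + b] with
    [A = w^(n/2 - 1) (w + e)], that is, [(A + 1)^2 - 2 (A + 1) + (b + 1)], where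
    4 does not divide b + 1. *)
Lemma regular_iv : cond_iv b d m p -> ~ inI2 F.
Proof.
have [l el] : exists l,
    (n = l.*2.+4 /\ n - 2 = l.+1 + l.+1 \/ n = l.*2.+3 /\ n - 2 = l.*2.+1)%N.
  by exists (n - 3)./2; lia.
move=> [ep podd b1] hF.
have [t et] : exists t, b = 4 * t + 1.
  by move: b1; clear; exists (b %/ 4)%Z; lia.
have := hF; rewrite FE => hF'.
have pe : p%:R = 2 :> {poly int} by rewrite ep.
have {podd} : ~~ (p %| d * b * m%:Z)%Z by rewrite ep.
rewrite dvdzM_prime // dvdzM_prime // !negb_or => /andP[/andP[pd pb] pm].
have {pd} ne : ~~ (2 %| e)%Z.
  by apply: contra pd; rewrite ep /d => h; apply: dvdz_mulr.
case: el => [[_ en]|[en en2]]; last first.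
  have [h|hX] := inI_deriv_f_at pr irG n3 pb pm hF'.
    have /andP[_ /negP] := notb pb hF; apply.
    have -> : w + e%:P = n%:R * w + (n - 2)%:R * e%:P - p%:R * (l.+1%:R * w + l%:R * e%:P).
      by rewrite en2 en -[_.*2.+3]addn3 -[_.*2.+1]addn1 -muln2 !natrD natrM pe -[l.+1]addn1 natrD; ring.
    by apply: inIB => //; apply: inIp.
  have /dvdz_psqr := inI_root_X pr irG m2 hX hF'.
  rewrite ep => h; have : (2 %| b)%Z.
    rewrite -[b](addKr (c ^+ (n - 2) * (c + e) ^+ 2)) rpredD // rpredN.
    by rewrite en2 even_mul_add_odd.
  by move=> h2; move: pb; rewrite ep h2.
pose A := w ^+ l.+1 * (w + e%:P).
have AE : f_at e b n w = (A + 1) ^+ 2 - p%:R * (A + 1) + (4 * t + 2)%:P.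
  rewrite /f_at /A et pe en.
  have -> : (4 * t + 1)%:P = (4 * t + 2)%:P - 1 :> {poly int}.
    have -> : 4 * t + 2 = (4 * t + 1) + 1 :> int by ring.
    by rewrite [in RHS]polyCD addrK.
  rewrite exprD; ring.
have hA : inI (A + 1).
  have := inI2W pr hF'; rewrite AE addrC inIDr; last first.
    by rewrite inIC // ep; clear; lia.
  by rewrite addrC inIDr ?inIN ?inIp // => /(inIX irG).
have : inI2 (4 * t + 2)%:P.
  have -> : (4 * t + 2)%:P = f_at e b n w - ((A + 1) ^+ 2 - p%:R * (A + 1)).
    by rewrite AE; ring.
  by apply: inI2B => //; apply: inI2B; [apply: inI2X | apply: inI2p].
by move=> /(inI2C pr irG); rewrite ep; clear; lia.
Qed.

(** As p divides e, [F] is congruent to [w^n + b] modulo p.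
    If k = 0, then p does not divide n, and [F'] in the ideal leaves only ['X] in
    the ideal, whence [f(c)] in the square.
    If k >= 1, put q = p^k.  By Frobenius [w^n + b] is congruent to
    [(w^s + b)^q] modulo p, so that [w^s] is congruent to -b modulo the ideal and
    [w^n] to [(-b)^q] modulo its square.  As [e^2] is in the square too, [F] is
    congruent there to [p (b1 + a1 w^(n-1))], so that [b1 + a1 w^(n-1)] is in the
    ideal.  Eliminating [w] with the help of [w^n = -b] gives the expression of
    condition (iii). *)
Lemma regular_iii : cond_iii a b c d n m p -> ~ inI2 F.
Proof.
have n1 : n = (n - 2).+2 by lia.
have np : n.-1 = (n - 2).+1 by lia.
move=> [pbm pd [s [k [ps ens k1 k0]]]] hF; have := hF; rewrite FE => hF'.
move: pbm; rewrite dvdzM_prime // negb_or => /andP[pb pm].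
have pe : (p %| e)%Z by apply: (dvdzX_prime pr pd).
have Pe : inI e%:P by apply: inIC_dvd.
have := notb pb hF; case/andP => nw _.
have [k_0|k_gt0] := posnP k.
  have [|hX] := inI_deriv_f_at pr irG n3 pb pm hF'.
    rewrite addrC inIDr; last exact: inIMl.
    rewrite inIM // (negPf nw) orbF -polyC_natr inIC // natz.
    by rewrite dvdzE ens k_0 muln1 (negPf ps).
  have := inI_root_X pr irG m2 hX hF'.
  by rewrite -f_polyE // (negPf (k0 k_0)).
pose q := (p ^ k)%N; pose H := w ^+ s + b%:P.
have pq : (p %| q)%N by rewrite dvdn_exp.
have wn : w ^+ n = (w ^+ s) ^+ q by rewrite -exprM ens.
have FE2 : f_at e b n w = w ^+ n + e%:P * (2 * w ^+ n.-1 + e%:P * w ^+ (n - 2)) + b%:P.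
  rewrite /f_at np.
  have -> : w ^+ n = w * (w * w ^+ (n - 2)) by rewrite -!exprS -n1.
  by rewrite !exprS; ring.
have wnb : inI (w ^+ n + b%:P).
  have := inI2W pr hF'; rewrite FE2 addrAC addrC inIDr //; exact: inIMr.
have hH : inI H.
  apply: (@inIX _ _ irG _ q).
  have [|z ->] := @redp_eqP p pr (H ^+ q) (w ^+ n + b%:P); last first.
    by apply: inID => //; apply: inIp.
  by rewrite redp_expD // redpC_exp // rmorphD wn [in RHS]rmorphXn.
have wnP2 : inI2 (w ^+ n - ((- b) ^+ q)%:P).
  rewrite wn rmorphXn rmorphN /=.
  by rewrite -{1}[w ^+ s](addrK b%:P); apply: inI2_expD.
set b1 := ((b + (- b) ^+ q) %/ p%:Z)%Z in k1.
set a1 := (a %/ p%:Z)%Z in k1.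
have eb1 : p%:R * b1%:P = (b + (- b) ^+ q)%:P :> {poly int}.
  rewrite -polyC_natr -rmorphM /= natz mulrC divzK // -intr_Fp_eq0 //.
  by rewrite rmorphD rmorphXn /= Fp_expX // rmorphN subrr.
have ea1 : p%:R * a1%:P = 2 * e%:P :> {poly int}.
  rewrite -polyC_natr -rmorphM /= natz mulrC divzK //; last by apply: dvdz_mull.
  by rewrite rmorphM /= (rmorph_nat _ 2).
have X : inI (b1%:P + a1%:P * w ^+ n.-1).
  apply: (inI2_pdiv pr irG); rewrite mulrDr mulrA eb1 ea1.
  have -> : (b + (- b) ^+ q)%:P + 2 * e%:P * w ^+ n.-1 =
      f_at e b n w - (w ^+ n - ((- b) ^+ q)%:P) - (e ^+ 2)%:P * w ^+ (n - 2).
    by rewrite FE2 !rmorphD !rmorphXn /=; ring.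
  by apply: inI2B; [apply: inI2B | apply/inI2Mr/inI2_sqr_dvd].
case: (k1 k_gt0) => [[pa1 /negP]|/negP]; apply.
  rewrite -(inIC pr irG); rewrite addrC inIDr // in X.
  by apply/inIMr/inIC_dvd.
apply: dvdz_mull; rewrite -(inIC pr irG).
rewrite !(rmorphB, rmorphM, rmorphXn, rmorphN) /=.
have -> : (- b1%:P) ^+ n - a1%:P ^+ n * (- b%:P) ^+ n.-1 =
   ((- b1%:P) ^+ n - (a1%:P * w ^+ n.-1) ^+ n)
   + a1%:P ^+ n * ((w ^+ n) ^+ n.-1 - (- b%:P) ^+ n.-1).
  rewrite exprMn; have -> : (w ^+ n.-1) ^+ n = (w ^+ n) ^+ n.-1 by rewrite -!exprM mulnC.
  ring.
apply: inID; last by apply/inIMl/inIB_exp; rewrite opprK.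
by apply: inIB_exp; rewrite -opprD inIN.
Qed.

End Cases.

(** * Regularity at all primes *)

(** The sum is the expansion of [(W - c)^(p^j)], [W = 'X^s + c], without its term
    [W^(p^j)].  So t is the error in Frobenius' congruence for
    ['X^m + c] and [W^(p^j)]. *)
Lemma t_polyE c s p j :
  t_poly c s p j = ('X^(p ^ j * s) + c%:P) - ('X^s + c%:P) ^+ (p ^ j).
Proof.
rewrite /t_poly; set W := 'X^s + c%:P; set q := (p ^ j)%N.
have -> : 'X^(q * s) = (W - c%:P) ^+ q by rewrite addrK -exprM mulnC.
rewrite exprBn -(big_mkord xpredT (fun i => (-1) ^+ i * W ^+ (q - i) * c%:P ^+ i *+ 'C(q, i))).
rewrite big_ltn // expr0 mul1r subn0 expr0 mulr1 bin0 mulr1n.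
rewrite -[_ + _ - W ^+ q]addrA [W ^+ q + _]addrC addrACA subrr addr0; congr (_ + _).
apply: eq_big_nat => i _; congr (_ *+ _).
by rewrite rmorphXn rmorphN /= [(- c%:P) ^+ i]exprNn mulrCA mulrA.
Qed.

Section CaseII.
Variables (p : nat) (pr : prime p) (G : {poly int}).
Hypothesis irG : irreducible_poly (redp p G).
Local Notation inI := (inI p G).
Local Notation inI2 := (inI2 p G).
Variables (a b c d : int) (m n : nat).
Hypotheses (n3 : (3 <= n)%N).
Let F := aux_poly a b c d n m.

Lemma divp_intK (X : {poly int}) : redp p X = 0 -> X = p%:R * divp_int p X.
Proof.
move=> X0; apply/polyP => i; rewrite mulr_natl coefMn coef_map_id0 ?div0z //.
rewrite -mulr_natr natz divzK // -intr_Fp_eq0 //.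
by rewrite -(coef_map (intr : {rmorphism int -> 'F_p})) X0 coef0.
Qed.

(** Let [W = 'X^s + c], q = p^j and [w = 'X^m + c = W^q + t], with t divisible by
    p; let [u] be such that [F = w^n + u(w)], and [Fs = W^n + u(W)].  By Frobenius
    [F] is congruent to [Fs^q] modulo p, so [Fs] is in the ideal.  Modulo the
    square, [w^n] is [W^(q n) + n W^(q (n-1)) t], and [W^(q n) = (Fs - u(W))^q] is
    [(- u(W))^q].  Hence [F] is congruent there to p times the second polynomial
    of condition (ii), which would be in the ideal together with [Fs]. *)
Lemma regular_ii : cond_ii a b c d n m p -> ~ inI2 F.
Proof.
have np : n = n.-1.+1 by lia.
move=> [_ _ [j [s [j1 ps em cop]]]] hF.
pose q := (p ^ j)%N; pose W : {poly int} := 'X^s + c%:P.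
pose w : {poly int} := 'X^m + c%:P.
pose u (x : {poly int}) := a *: x ^+ n.-1 + d *: x ^+ (n - 2) + b%:P.
have auxE k : aux_poly a b c d n k = ('X^k + c%:P) ^+ n + u ('X^k + c%:P).
  by rewrite /aux_poly /u !addrA.
have pq : (p %| q)%N by rewrite dvdn_exp.
have q2 : (2 <= q)%N.
  apply: leq_trans (prime_gt1 pr) (dvdn_leq _ pq).
  by rewrite expn_gt0 prime_gt0.
have Wq : redp p (W ^+ q) = redp p w.
  rewrite redp_expD // redpC_exp // [in RHS]rmorphD -rmorphXn -exprM em mulnC //.
have uq : redp p (u W ^+ q) = redp p (u w).
  have fD (x y : {poly 'F_p}) : (x + y) ^+ q = x ^+ q + y ^+ q.
    by rewrite exprDn_pchar ?pnat_pchar_Fp.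
  have uE x : redp p (u x) = redp p a%:P * redp p x ^+ n.-1
      + redp p d%:P * redp p x ^+ (n - 2) + redp p b%:P.
    by rewrite /u !rmorphD /= -!mul_polyC !rmorphM /= !rmorphXn.
  rewrite rmorphXn /= !uE !fD !exprMn !(redpC_exp pr j) -Wq rmorphXn /=.
  by rewrite -!exprM ![(q * _)%N]mulnC.
pose t := w - W ^+ q.
have t0 : redp p t = 0 by rewrite rmorphB /= Wq subrr.
pose S := second_poly a b c d n m s p j.
pose X0 := W ^+ (q * n.-1) * t *+ n + ((- u W) ^+ q + u w).
have pS : X0 = p%:R * S.
  rewrite /S /second_poly t_polyE -/q -em -/w -/W -/t -/(u W) -/(u w) -exprNn.
  apply: divp_intK; rewrite rmorphD rmorphMn rmorphM /= t0 mulr0 mul0rn add0r.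
  rewrite rmorphD rmorphXn rmorphN /= exprNn_pchar ?pnat_pchar_Fp //.
  by rewrite -(rmorphXn (map_poly intr) q (u W)) /= uq addNr.
have [t' et] : exists t', t = p%:R * t' by apply/(redp_eq0P pr)/eqP.
have [z ez] := exprD_mod_sqr t (W ^+ q) n.-1.
have ew : t + W ^+ q = w by rewrite subrK.
have hs : inI (W ^+ n + u W).
  apply: (@inIX _ _ irG _ q).
  have := inI2W pr hF; rewrite /inI; congr (_ %| _).
  rewrite redp_expD // /F auxE -/w [LHS]rmorphD /= -uq; congr (_ + _); last exact: rmorphXn.
  by rewrite !rmorphXn /= -Wq rmorphXn /= -!exprM mulnC.
have hX : inI2 X0.
  have -> : X0 = F - (((W ^+ n + u W) - u W) ^+ q - (- u W) ^+ q) - t ^+ 2 * z.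
    rewrite addrK -exprM /F auxE -/w -{1}ew np ez -np /X0.
    rewrite -[W ^+ q ^+ n]exprM -[W ^+ q ^+ n.-1]exprM [(n * q)%N]mulnC.
    by rewrite -[_ *+ n]mulr_natl; ring.
  apply: inI2B; last first.
    by rewrite et; apply/inI2Mr/inI2X => //; apply: inIp.
  by apply: inI2B => //; apply: inI2_expD.
move: hX; rewrite pS => /(inI2_pdiv pr irG) hS.
have /coprimepP/(_ (redp p G)) := cop.
rewrite auxE => /(_ hs hS); rewrite -size_poly_eq1; have [+ _] := irG.
by move=> lt1 /eqP e; rewrite e in lt1.
Qed.

End CaseII.

Lemma aux_poly_monic (a b c d : int) m n : (2 <= m)%N -> (3 <= n)%N ->
  aux_poly a b c d n m \is monic /\ size (aux_poly a b c d n m) = (m * n).+1.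
Proof.
move=> m2 n3; pose w : {poly int} := 'X^m + c%:P.
have sw : size w = m.+1 by rewrite size_XnaddC //; lia.
have mw : w \is monic by rewrite monicXnaddC //; lia.
have sX k : size (w ^+ k) = (m * k).+1 
  by rewrite -[LHS]prednK ?size_exp ?sw // size_poly_gt0 monic_neq0 ?monic_exp.
pose r := a *: w ^+ n.-1 + d *: w ^+ (n - 2) + b%:P.
have -> : aux_poly a b c d n m = w ^+ n + r by rewrite /r /aux_poly !addrA.
have sr : (size r < size (w ^+ n))%N.
  rewrite sX ltnS; apply: leq_trans (size_polyD _ _) _.
  rewrite geq_max (leq_trans (size_polyC_leq1 _)) ?andbT; last by nia.
  apply: leq_trans (size_polyD _ _) _; rewrite geq_max.
  apply/andP; split; apply: leq_trans (size_scale_leq _ _) _; rewrite sX.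
    by rewrite ltn_pmul2l; lia.
  by rewrite ltn_pmul2l; lia.
by split; [rewrite monicE lead_coefDl // -monicE monic_exp | rewrite size_polyDl].
Qed.

(** The hypothesis on cubics is there because for n = 3, [regular_i] covers only
    the p that divide e; the Galois condition will supply it. *)
Theorem all_regular (e b c : int) (n m : nat) :
  (3 <= n)%N -> (2 <= m)%N ->
  disc_primes_condition (2 * e) b c (e ^+ 2) n m ->
  (n = 3%N -> forall p, prime p -> cond_i b p -> (p %| e)%Z) ->
  forall p, prime p -> regular_at p (aux_poly (2 * e) b c (e ^+ 2) n m).
Proof.
move=> n3 m2 hd h3 p pr.
have [hp G irG|] := boolP (p %| discriminant (aux_poly (2 * e) b c (e ^+ 2) n m))%Z.
  have [hi|[hii|[hiii|[hiv|hv]]]] := hd p pr hp.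
  - rewrite aux_polyE ?(ltnW n3) //; apply: regular_i => //; rewrite ?(ltnW n3) //.
    + case: ltnP => //= n_le; apply: (h3 _ p) => //; lia.
    + by case: hi.
    + by case: hi.
  - exact: regular_ii hii.
  - exact: regular_iii hiii.
  - exact: regular_iv hiv.
  - exact: regular_v hv.
have [mon sz] := aux_poly_monic (2 * e) b c (e ^+ 2) m2 n3.
by apply: regular_ndisc => //; rewrite sz; nia.
Qed.

(** * Descent in characteristic two *)

Section CharTwo.
Implicit Types A B P Q S phi : {poly 'F_2}.

Lemma pchar2_polyF2 : 2%N \in [pchar {poly 'F_2}].
Proof.
rewrite (rmorph_pchar (polyC : {rmorphism 'F_2 -> {poly 'F_2}})) //.
Qed.

Lemma sqr_polyF2 P : P ^+ 2 = P \Po 'X^2.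
Proof.
elim/poly_ind: P => [|P c IH]; first by rewrite comp_poly0 expr0n.
rewrite comp_poly_MXaddC -IH exprDn_pchar ?exprMn -?rmorphXn /=.
  by congr (_ + _%:P); rewrite -{2}(@Fp_cast 2) // -[X in _ ^+ X](card_Fp (isT : prime 2)) expf_card.
by rewrite pnatE // pchar2_polyF2.
Qed.

Lemma sqrD_polyF2 P Q : (P + Q) ^+ 2 = P ^+ 2 + Q ^+ 2.
Proof. by rewrite exprDn_pchar // pnatE // pchar2_polyF2. Qed.

Lemma sqr_inj_polyF2 P Q : P ^+ 2 = Q ^+ 2 -> P = Q.
Proof.
move=> e; apply/eqP; rewrite -subr_eq0 -sqrf_eq0 (oppr_pchar2 pchar2_polyF2).
by rewrite sqrD_polyF2 e addrr_pchar2 // pchar2_polyF2.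
Qed.

(** A polynomial with derivative 0 is of the form [A(X^2)], which is [A^2] over
    F_2. *)
Lemma deriv0_sqr P : P^`() = 0 -> exists A, P = A ^+ 2.
Proof.
move=> dP; exists (even_poly P); rewrite sqr_polyF2 -[LHS]poly_even_odd.
suff -> : odd_poly P = 0 by rewrite comp_poly0 mul0r addr0.
apply/polyP => i; rewrite coef_odd_poly coef0.
have := congr1 (fun q : {poly 'F_2} => q`_i.*2) dP; rewrite coef_deriv coef0.
by rewrite mulrS -muln2 mulrnA (mulrn_pchar (pchar_Fp (isT : prime 2))) addr0.
Qed.

Lemma deriv_sqr0 P : (P ^+ 2)^`() = 0.
Proof. by rewrite deriv_exp -mulr_natl (pcharf0 pchar2_polyF2) mul0r. Qed.

(** [A] divides [A' B], hence [A'], which has smaller degree. *)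
Lemma coprime_deriv0 A B : coprimep A B -> (A * B)^`() = 0 ->
  (exists A1, A = A1 ^+ 2) /\ (exists B1, B = B1 ^+ 2).
Proof.
suff main P Q : coprimep P Q -> (P * Q)^`() = 0 -> exists A1, P = A1 ^+ 2.
  move=> cAB dAB; split; first exact: main dAB.
  by apply: (main B A); rewrite 1?coprimep_sym // mulrC.
move=> cPQ; rewrite derivM => dPQ; apply: deriv0_sqr; apply/eqP.
have : P %| P^`() * Q.
  have -> : P^`() * Q = - (P * Q^`()) by apply/eqP; rewrite -addr_eq0 dPQ.
  by rewrite dvdpNr dvdp_mulr.
rewrite Gauss_dvdpl // => dv; apply: contraTT isT => P'0.
have P0 : P != 0 by apply: contraNneq P'0 => ->; rewrite deriv0.
by have := leq_trans (lt_size_deriv P0) (dvdp_leq P'0 dv); rewrite ltnn.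
Qed.

Lemma size_sqr_polyF2 P : P != 0 -> (size (P ^+ 2)).-1 = ((size P).-1).*2.
Proof. by move=> P0; rewrite size_exp muln2. Qed.

Lemma comp_polyXn_double phi k : phi \Po 'X^(k.*2) = (phi \Po 'X^k) ^+ 2.
Proof. by rewrite sqr_polyF2 -comp_polyA comp_Xn_poly -exprM mul2n. Qed.

Lemma coprimep_sqr A B : coprimep (A ^+ 2) (B ^+ 2) = coprimep A B.
Proof. by rewrite coprimep_pexpl // coprimep_pexpr. Qed.

(** The condition on the degree of [A] makes [M = 2 M'] even, so that the
    right-hand side is the square of [phi(X^M')].  Then [A B] is a square as well,
    hence so are [A] and [B]; square roots of both sides give the same situation
    for M', and the descent never ends. *)
Lemma norm_form_descent phi (k : 'F_2) M A B : (0 < M)%N ->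
  coprimep A B -> (size A).-1.*2 = (3 * M)%N ->
  A ^+ 2 + A * B + k%:P * B ^+ 2 <> phi \Po 'X^M.
Proof.
elim/ltn_ind: M A B => M IH A B M0 cAB sA e.
have [M' eM] : exists M', M = M'.*2 by exists M./2; lia.
have k2 : k%:P = k%:P ^+ 2 :> {poly 'F_2}.
  by rewrite sqr_polyF2 comp_polyC.
have [||[A1 eA] [B1 eB]] := @coprime_deriv0 A B => //.
  have -> : A * B = (A + k%:P * B + (phi \Po 'X^M')) ^+ 2.
    rewrite !sqrD_polyF2 exprMn -k2 -comp_polyXn_double -eM -e.
    have x2 x : x + x = 0 := addrr_pchar2 pchar2_polyF2 x.
    move: (A ^+ 2) (k%:P * B ^+ 2) => x y.
    have -> : x + y + (x + A * B + y) = A * B + (x + x) + (y + y) by ring.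
    by rewrite !x2 !addr0.
  exact: deriv_sqr0.
have A10 : A1 != 0.
  by apply/eqP => A10; move: sA; rewrite eA A10 expr0n size_poly0; lia.
apply: (IH M' _ A1 B1); try lia.
- by rewrite -coprimep_sqr -eA -eB.
- move: sA; rewrite eA size_sqr_polyF2 // eM. move: (size A1).-1 => x. clear. lia.
apply: sqr_inj_polyF2; rewrite -comp_polyXn_double -eM -e !sqrD_polyF2.
by rewrite !exprMn -k2 -eA -eB.
Qed.

(** The coprime factors of a square are squares; then M is even, and square roots
    give the same situation for M / 2. *)
Lemma split_square_descent phi M P Q : (0 < M)%N ->
  coprimep P Q -> (size P).-1 = M -> P * Q <> (phi \Po 'X^M) ^+ 2.
Proof.
elim/ltn_ind: M P Q => M IH P Q M0 cPQ sP e.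
have [||[P1 eP] [Q1 eQ]] := @coprime_deriv0 P Q => //.
  by rewrite e deriv_sqr0.
have P10 : P1 != 0.
  by apply: contraTneq M0 => P10; rewrite -sP eP P10 expr0n size_poly0.
have eM : M = (size P1).-1.*2 by rewrite -sP eP size_sqr_polyF2.
apply: (IH (size P1).-1 _ P1 Q1) => //; try lia.
  by rewrite -coprimep_sqr -eP -eQ.
apply: sqr_inj_polyF2; rewrite exprMn -eP -eQ e [in LHS]eM.
by rewrite comp_polyXn_double.
Qed.

End CharTwo.

(** * Integral coefficients of factors *)

Section Integral.
Variable K : fieldType.
Local Notation integral := (integralOver (intr : int -> K)).

Lemma integral_coef_XsubC (rs : seq K) i :
  (forall x, x \in rs -> integral x) ->
  integral (\prod_(x <- rs) ('X - x%:P))`_i.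
Proof.
elim: rs i => [|x rs IH] i hrs.
  by rewrite big_nil coef1; apply: integral_nat.
rewrite big_cons mulrBl coefB coefXM coefCM.
have {}IH k := IH k (fun y h => hrs y (mem_behead (h : y \in behead (x :: rs)))).
apply: integral_sub; first by case: eqP => _ //; apply: mxpoly.integral0.
by apply: integral_mul => //; apply: hrs; rewrite mem_head.
Qed.

Lemma integral_factor (rs : seq K) (P : {poly K}) i :
  (forall x, x \in rs -> integral x) -> P \is monic ->
  P %| \prod_(x <- rs) ('X - x%:P) -> integral P`_i.
Proof.
move=> hrs monP /dvdp_prod_XsubC[msk]; set Q := \prod_(_ <- _) _.
rewrite (eqp_monic monP) ?monic_prod_XsubC // => /eqP->.
by apply: integral_coef_XsubC => x /mem_mask; apply: hrs.
Qed.
End Integral.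

Lemma clear_denominators (K : fieldType) (iota : {rmorphism rat -> K}) x q :
  exists2 M, (0 < M)%N & exists h, M%:R * (map_poly iota q).[x] = zev x h.
Proof.
have [h [z z0 ->]] := rat_poly_scale q.
exists `|z|%N; first by rewrite absz_gt0.
exists ((Num.sg z)%:P * h); rewrite rmorphM /= zevC zevE.
rewrite linearZ /= hornerZ -map_poly_comp.
have -> : map_poly (iota \o intr) h = map_poly intr h :> {poly K}.
  by apply: eq_map_poly => k /=; rewrite rmorph_int.
have -> : `|z|%N%:R = (Num.sg z * z)%:~R :> K by rewrite -abszEsg.
rewrite intrM -mulrA fmorphV rmorph_int mulVKf //.
by rewrite -(rmorph_int iota) fmorph_eq0 intr_eq0.
Qed.

Section Lift.
Variables (L : fieldExtType rat) (tau : L) (T : {poly int}).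
Hypotheses (minT : is_zminpoly tau T) (monT : T \is monic).
Local Notation integral := (integralOver (intr : int -> L)).

Lemma integral_zroot (x : L) (F : {poly int}) : F \is monic -> zev x F = 0 -> integral x.
Proof. by move=> monF F0; exists F => //; apply/rootP. Qed.

Lemma Fadjoin1_zev (x y : L) : y \in <<1; x>>%VS ->
  exists2 M, (0 < M)%N & exists h, M%:R * y = zev x h.
Proof. by move=> /Fadjoin1_polyP[q ->]; apply: clear_denominators. Qed.

Variable p : nat.
Hypotheses (pr : prime p) (reg : regular_at p T).

Lemma lift_coef y : y \in <<1; tau>>%VS -> integral y ->
  exists2 N, ~~ (p %| N)%N & exists h, N%:R * y = zev tau h.
Proof.
move=> /Fadjoin1_zev[M M0 [h e]] iy.
have it : integral tau by apply: (integral_zroot monT); case: minT.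
have [N [h' [N0 e' hN]]] := integral_denominator minT (in_alg L) monT it iy M0 e.
by exists N; [apply: hN | exists h'].
Qed.

(** The values of the coefficients of [P2] are those of [P] up to a common factor
    prime to p.  Coefficients in Z[x] rather than in Z[tau] can be evaluated
    elsewhere, in particular at an approximate root of [T] modulo powers of p. *)
Lemma lift_poly (P : {poly L}) : P \is a polyOver <<1; tau>>%VS ->
  (forall i, integral P`_i) ->
  exists2 N, ~~ (p %| N)%N & exists2 P2 : {poly {poly int}},
    (size P2 <= size P)%N & forall i, N%:R * P`_i = zev tau P2`_i.
Proof.
move=> /polyOverP PE Pi.
suff main k : exists2 N, ~~ (p %| N)%N & exists2 H : nat -> {poly int},
    True & forall i, (i < k)%N -> N%:R * P`_i = zev tau (H i).
  have [N pN [H _ HE]] := main (size P); exists N => //.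
  exists (\poly_(i < size P) H i); first exact: size_poly.
  move=> i; rewrite coef_poly; case: ltnP => [/HE//|/(nth_default 0)->].
  by rewrite mulr0 rmorph0.
elim: k => [|k [N pN [H _ HE]]]; first by exists 1%N; [rewrite dvdn1 neq_ltn prime_gt1 ?orbT | exists (fun=> 0)].
have [N' pN' [h e]] := lift_coef (PE k) (Pi k).
exists (N * N')%N; first by rewrite Euclid_dvdM // negb_or pN.
exists (fun i => if (i < k)%N then N'%:R * H i else N%:R * h) => // i.
rewrite ltnS leq_eqVlt => /orP[/eqP->|ltik].
  by rewrite ltnn natrM -mulrA e rmorphM /= rmorph_nat.
by rewrite ltik natrM mulrAC HE // rmorphM /= rmorph_nat mulrC.
Qed.

End Lift.

(** * Norm forms over a quadratic subfield *)

Lemma aux_poly_comp a b c d n k :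
  aux_poly a b c d n k = aux_poly a b c d n 1 \Po 'X^k.
Proof.
rewrite /aux_poly !comp_polyD !comp_polyZ !rmorphXn /= !comp_polyD !comp_polyC.
by rewrite comp_polyX.
Qed.

Lemma regular_deriv_unit p (T : {poly int}) : prime p ->
  (forall G, irreducible_poly (redp p G) -> inI p G T -> inI p G T^`() -> inI p G 1) ->
  regular_at p T.
Proof.
move=> pr h G irG hT; have := h G irG (inI2W pr hT) (inI2_deriv pr hT).
by rewrite inI1.
Qed.

Lemma coprime_irred (F : fieldType) (A B : {poly F}) : A != 0 ->
  (forall g, irreducible_poly g -> g %| A -> g %| B -> False) -> coprimep A B.
Proof.
move=> A0 h; rewrite /coprimep eqn_leq leqNgt; apply/andP; split.
  apply/negP => /irreducible_factor[g ig]; rewrite dvdp_gcd => /andP[gA gB].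
  exact: h gA gB.
by rewrite size_poly_gt0 gcdp_eq0 negb_and A0.
Qed.

Section Field.
Variables (L : fieldExtType rat) (theta : L) (F : {poly int}) (rs : seq L).
Hypotheses (monF : F \is monic) (minF : is_zminpoly theta F).
Hypothesis genL : <<1; theta>>%VS = fullv.
Hypothesis splitF : map_poly intr F = \prod_(x <- rs) ('X - x%:P).
Local Notation integral := (integralOver (intr : int -> L)).

Lemma integral_rs x : x \in rs -> integral x.
Proof.
move=> xrs; exists F => //.
by rewrite splitF root_prod_XsubC.
Qed.

Lemma integral_factorF (P : {poly L}) i : P \is monic -> P %| map_poly intr F -> integral P`_i.
Proof.
by move=> monP; rewrite splitF; apply: integral_factor => //; apply: integral_rs.
Qed.

Lemma polyOver_int (E : {subfield L}) (P : {poly int}) :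
  (map_poly intr P : {poly L}) \is a polyOver E.
Proof. by apply/polyOverP => i; rewrite coef_map rpred_int. Qed.

Lemma genL_over (E : {subfield L}) x : <<1; x>>%VS = fullv -> <<E; x>>%VS = fullv.
Proof.
move=> gx; apply/eqP; rewrite eqEsubv subvf /= -[X in (X <= _)%VS]gx.
exact/adjoinSl/sub1v.
Qed.

Lemma size_minPoly_dim (E : {subfield L}) x : <<1; x>>%VS = fullv ->
  (((size (minPoly E x)).-1 * \dim E)%N = \dim {:L}).
Proof. by move=> gx; rewrite size_minPoly -dim_Fadjoin genL_over. Qed.

Lemma size_map_monic (T : {poly int}) : T \is monic ->
  size (map_poly intr T : {poly L}) = size T.
Proof. by move=> monT; rewrite size_map_poly_id0 // (monicP monT) oner_eq0. Qed.

Lemma dim_quadratic (x : L) (T : {poly int}) : T \is monic -> size T = 3%N ->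
  zev x T = 0 -> x \notin 1%VS -> \dim <<1; x>> = 2.
Proof.
move=> monT sT T0 xQ.
have n1 : adjoin_degree 1%AS x != 1%N by rewrite adjoin_deg_eq1.
have n0 : (0 < adjoin_degree 1%AS x)%N by [].
rewrite (dim_Fadjoin 1%AS x) dimv1 muln1.
suff : (adjoin_degree 1%AS x < 3)%N by move: n1 n0; case: adjoin_degree => [|[|[|]]].
rewrite -size_minPoly -sT -size_map_monic //.
apply: dvdp_leq; first by rewrite -size_poly_eq0 size_map_monic // sT.
by apply: minPoly_dvdp; [apply: polyOver_int | apply/rootP].
Qed.

(** The minimal polynomial of x over Q, multiplied by a common denominator, is a
    multiple of [T]. *)
Lemma dim_zminpoly (x : L) (T : {poly int}) : T \is monic -> is_zminpoly x T ->
  \dim <<1; x>> = (size T).-1.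
Proof.
move=> monT [T0 minT].
have sm := size_minPoly 1%AS x.
rewrite (dim_Fadjoin 1%AS x) dimv1 muln1 -[LHS]/((adjoin_degree 1%AS x).+1.-1) -sm.
congr _.-1; apply/eqP; rewrite eqn_leq; apply/andP; split.
  rewrite -size_map_monic // dvdp_leq //.
    by rewrite -size_poly_eq0 size_map_monic // size_poly_eq0 monic_neq0.
  by apply: minPoly_dvdp; [apply: polyOver_int | apply/rootP].
have /polyOver1P[q eq_] := minPolyOver 1%AS x.
have [h [z z0 eh]] := rat_poly_scale q.
have q0 : q != 0.
  by apply: contraTneq (monic_minPoly 1%AS x) => q0; rewrite eq_ q0 rmorph0 monicE lead_coef0 eq_sym oner_eq0.
have zQ : (z%:~R : rat)^-1 != 0 by rewrite invr_eq0 intr_eq0.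
have [|D eD] := minT h.
  have := minPolyxx 1%AS x; rewrite eq_ eh map_polyZ hornerZ => /eqP.
  rewrite mulf_eq0 fmorph_eq0 (negPf zQ) -map_poly_comp /= => /eqP<-.
  by rewrite zevE; congr (_.[_]); apply: eq_map_poly => k /=; rewrite -[LHS](rmorph_int (in_alg L)).
have h0 : h != 0 by apply: contraNneq q0 => h0; rewrite eh h0 rmorph0 scaler0.
rewrite eq_ size_map_poly eh size_scale // size_map_inj_poly //; last exact: intr_inj.
have D0 : D != 0 by apply: contraNneq h0 => D0; rewrite eD D0 mulr0.
by rewrite eD (size_monicM monT D0) (polySpred D0) addnS leq_addr.
Qed.

Section Quadratic.
Variables (k : int) (eps : L).
Hypotheses (eps2 : eps ^+ 2 = eps + k%:~R) (epsQ : eps \notin 1%VS).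

Lemma quad_free (u v : int) : u%:~R + v%:~R * eps = 0 -> u = 0 /\ v = 0.
Proof.
move=> e; have v0 : v = 0; last first.
  by move: e; rewrite v0 mul0r addr0 => /eqP; rewrite -(rmorph_int (in_alg L)) fmorph_eq0 intr_eq0 => /eqP.
apply/eqP; apply: contraNT epsQ => v0.
have vL : v%:~R != 0 :> L by rewrite -(rmorph_int (in_alg L)) fmorph_eq0 intr_eq0.
have -> : eps = in_alg L (- u%:~R / v%:~R).
  apply: (mulfI vL); rewrite fmorph_div rmorphN !rmorph_int mulrCA mulfV // mulr1.
  by apply/eqP; rewrite -addr_eq0 addrC e.
by rewrite /= memvZ // mem1v.
Qed.

Let T : {poly int} := 'X^2 + (- 'X - k%:P).

Let szT : size (- 'X - k%:P : {poly int}) = 2%N.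
Proof. by rewrite -opprD size_polyN size_XaddC. Qed.

Let monT : T \is monic.
Proof. by rewrite monicE lead_coefDl ?lead_coefXn // szT size_polyXn. Qed.

Let sizeT : size T = 3%N.
Proof. by rewrite size_polyDl ?szT size_polyXn. Qed.

Let T0 : zev eps T = 0.
Proof.
by rewrite /T !(rmorphD, rmorphN, rmorphXn) /= zevX zevC eps2; ring.
Qed.

Let quad_rep h : exists uv : int * int, zev eps h = uv.1%:~R + uv.2%:~R * eps.
Proof.
elim/poly_ind: h => [|h z [[u v] /= IH]]; first by exists (0, 0); rewrite rmorph0 /= mulr0z mul0r addr0.
exists (v * k + z, u + v); rewrite rmorphD rmorphM /= zevX zevC IH.
rewrite mulrDl -mulrA -expr2 eps2; ring.
Qed.

Let minT : is_zminpoly eps T.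
Proof.
split=> // Y Y0.
pose R := Pdiv.CommonRing.rmodp Y T; pose Q := Pdiv.CommonRing.rdivp Y T.
have eY : Y = Q * T + R := Pdiv.RingMonic.rdivp_eq monT Y.
exists Q; rewrite mulrC eY; suff -> : R = 0 by rewrite addr0.
have R0 : zev eps R = 0 by move: Y0; rewrite eY rmorphD rmorphM /= T0 mulr0 add0r.
have sR : (size R <= 2)%N.
  by have := Pdiv.CommonRing.ltn_rmodpN0 Y (monic_neq0 monT); rewrite sizeT.
have eR : R = (R`_0)%:P + (R`_1)%:P * 'X.
  apply/polyP => i; rewrite coefD coefCM coefC coefX.
  case: i => [|[|i]] /=; rewrite ?mulr0 ?addr0 ?mulr1 ?add0r //.
  by rewrite nth_default // (leq_trans sR).
move: R0; rewrite {1}eR rmorphD rmorphM /= zevX !zevC => /quad_free[e0 e1].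
by rewrite eR e0 e1 mul0r addr0.
Qed.

(* The derivative 2 X - 1 is a unit modulo 2. *)
Let reg2T : regular_at 2 T.
Proof.
apply: regular_deriv_unit => // G irG _ hT'.
have -> : 1 = 2%:R * 'X - T^`().
  by rewrite /T !poly.derivE /= -mulr_natl; ring.
by apply: inIB => //; apply: inIp.
Qed.

Let dimE : \dim <<1; eps>> = 2.
Proof. exact: dim_quadratic monT sizeT T0 epsQ. Qed.

(** Z[eps] is regular at 2, so an odd multiple of the minimal polynomial of theta
    over Q(eps) is of the form [A + eps B].  It vanishes at theta, hence so does its
    norm [A^2 + A B - k B^2].  As the minimal polynomial is monic, the leading
    coefficient of [A] is odd and [B] has smaller degree. *)
Lemma norm_form : exists A B D : {poly int},
  [/\ A ^+ 2 + A * B - k%:P * B ^+ 2 = F * D,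
      (size (redp 2 A)).-1.*2 = \dim {:L},
      redp 2 A != 0 &
      (size (redp 2 B) < size (redp 2 A))%N].
Proof.
pose P := minPoly <<1; eps>>%AS theta.
have sP := size_minPoly_dim <<1; eps>>%AS genL; rewrite dimE muln2 -/P in sP.
have monP : P \is monic by apply: monic_minPoly.
have dvP : P %| map_poly intr F.
  by apply: minPoly_dvdp; [apply: polyOver_int | apply/rootP; case: minF].
have [||N N2 [P2 sP2 eP2]] := @lift_poly L eps T minT monT 2 isT reg2T P.
- exact: minPolyOver.
- by move=> i; apply: integral_factorF.
have [U HU] := choice (fun i => quad_rep P2`_i).
pose d := (size P).-1.
have sPd : size P = d.+1 by rewrite prednK // size_poly_gt0 monic_neq0.
pose A := \poly_(i < d.+1) (U i).1; pose B := \poly_(i < d.+1) (U i).2.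
have [Ad Bd] : A`_d = N%:R /\ B`_d = 0.
  rewrite !coef_poly ltnSn.
  have Pd : P`_d = 1 by have := monicP monP; rewrite lead_coefE sPd.
  have := eP2 d; rewrite Pd mulr1 HU => e.
  have [|e1 e2] := @quad_free ((U d).1 - N%:R) (U d).2.
    by rewrite intrB addrAC -e -(rmorph_nat intr) subrr.
  by split=> //; apply/eqP; rewrite -subr_eq0 e1.
have N1 : (N%:R : 'F_2) != 0 by rewrite -(dvdn_pcharf (pchar_Fp (isT : prime 2))).
have Ad2 : (redp 2 A)`_d != 0 by rewrite coef_map /= Ad rmorph_nat.
have sA : size (redp 2 A) = d.+1.
  apply/eqP; rewrite eqn_leq; apply/andP; split.
    by apply: leq_trans (size_poly _ _) _; apply: size_poly.
  by rewrite ltnNge; apply: contra Ad2 => /(nth_default 0)->.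
have sB : (size (redp 2 B) <= d)%N.
  apply/leq_sizeP => j; rewrite leq_eqVlt coef_map => /orP[/eqP<-|ltdj].
    by rewrite /= Bd.
  by rewrite coef_poly ltnS leqNgt ltdj  /=.
have AB : map_poly intr A + eps *: map_poly intr B = N%:R *: P.
  apply/polyP => i; rewrite coefD !coefZ !coef_map eP2 HU !coef_poly /=.
  case: ltnP => [_|h]; first by rewrite [eps * _]mulrC.
  have : N%:R * P`_i = 0 by rewrite nth_default ?mulr0 // sPd.
  by rewrite eP2 HU => ->; rewrite mulr0 addr0.
have AB0 : zev theta A = - (eps * zev theta B).
  apply/eqP; rewrite -addr_eq0 !zevE -hornerZ -hornerD AB hornerZ.
  by rewrite minPolyxx mulr0.
have [D eD] : exists D, A ^+ 2 + A * B - k%:P * B ^+ 2 = F * D.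
  apply: minF.2; rewrite !(rmorphB, rmorphD, rmorphM, rmorphXn) /= zevC AB0.
  move: (zev theta B) => z; transitivity ((eps ^+ 2 - eps - k%:~R) * z ^+ 2); first by ring.
  by rewrite eps2; ring.
exists A, B, D; split=> //; last by rewrite sA.
  by rewrite sA.
by rewrite -size_poly_eq0 sA.
Qed.

End Quadratic.
End Field.

(** * The Galois condition for cubics *)

Lemma zev_comp (K : fieldType) (x : K) (Y w : {poly int}) :
  zev x (Y \Po w) = zev (zev x w) Y.
Proof. by rewrite !zevE map_comp_poly horner_comp. Qed.

Lemma int_square_dvd (q : rat) (z : int) : q ^+ 2 = z%:~R ->
  forall p, prime p -> (p %| z)%Z -> ((p ^ 2)%N %| z)%Z.
Proof.
move=> e p pr pz.
have qd : (denq q)%:~R != 0 :> rat by rewrite intr_eq0 denq_eq0.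
have e2 : numq q ^+ 2 = z * denq q ^+ 2.
  apply: (@intr_inj rat); rewrite [RHS]intrM !rmorphXn /= -e -exprMn; congr (_ ^+ 2).
  by rewrite -{2}(divq_num_den q) divfK.
have pn : (p %| numq q)%Z by apply: (@dvdzX_prime _ _ 2 pr); rewrite e2 dvdz_mulr.
have /dvdzP[y ey] := pn.
have pd : ~~ (p %| denq q)%Z.
  apply/negP => pd; have := coprime_num_den q; move: pn pd; rewrite !dvdzE /= => pn pd.
  by move=> /(coprime_dvdl pn)/(coprime_dvdr pd); rewrite /coprime gcdnn => /eqP p1; rewrite p1 in pr.
have : ((p ^ 2)%N %| z * denq q ^+ 2)%Z.
  by rewrite -e2 ey exprMn; apply/dvdzP; exists (y ^+ 2); rewrite -mulnn PoszM expr2.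
rewrite Gauss_dvdzl // coprimezE abszX /= coprime_pexpl // coprime_pexpr // prime_coprime //.
Qed.

Lemma cubic_factor (R : comNzRingType) (x y e : R) :
  (x - y) * (x ^+ 2 + (y + 2 * e) * x + (y + e) ^+ 2) =
  x * (x + e) ^+ 2 - y * (y + e) ^+ 2.
Proof. ring. Qed.

Lemma int_even (x : int) : (2 %| x)%Z -> exists y, x = 2 * y.
Proof. by move=> /dvdzP[y ->]; exists y; rewrite mulrC. Qed.

Lemma int_odd (x : int) : ~~ (2 %| x)%Z -> exists y, x = 2 * y + 1.
Proof. by exists (x %/ 2)%Z; lia. Qed.

Lemma int_2mod4 (x : int) : (2 %| x)%Z -> ~~ (4 %| x)%Z ->
  exists y, x = 4 * y + 2.
Proof. by exists (x %/ 4)%Z; lia. Qed.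

(** The value at 2 of w (w + e)^2 + b. *)
Lemma mod4_root (e b : int) : ~~ (2 %| e)%Z -> (2 %| b)%Z -> ~~ (4 %| b)%Z ->
  exists k, 2 * (2 + e) ^+ 2 + b = 4 * k.
Proof.
move=> ne pb n4; have [x ex] := int_odd ne.
have [y ey] := int_2mod4 pb n4.
by exists (2 * x ^+ 2 + 6 * x + 5 + y); rewrite ex ey; ring.
Qed.

Lemma sqr_2e_3_ndvd4 (e : int) : ~~ (2 %| e)%Z -> ~~ (4 %| e ^+ 2 + 2 * e + 3)%Z.
Proof.
move=> ne; have [x ->] := int_odd ne.
have -> : (2 * x + 1) ^+ 2 + 2 * (2 * x + 1) + 3 = 4 * (x ^+ 2 + 2 * x + 1) + 2 by ring.
lia.
Qed.

Lemma sqr_2e_3_dvd2 (e : int) : ~~ (2 %| e)%Z -> (2 %| e ^+ 2 + 2 * e + 3)%Z.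
Proof.
move=> ne; have [x ->] := int_odd ne.
have -> : (2 * x + 1) ^+ 2 + 2 * (2 * x + 1) + 3 = 2 * (2 * x ^+ 2 + 4 * x + 3) by ring.
exact: dvdz_mulr.
Qed.

Local Notation ev := (horner_eval (2 : int)).

Section Cubic.
Variables (e b c : int) (m : nat).
Hypothesis m2 : (2 <= m)%N.
Let F := aux_poly (2 * e) b c (e ^+ 2) 3 m.
Let w : {poly int} := 'X^m + c%:P.
Let f : {poly int} := 'X * ('X + e%:P) ^+ 2 + b%:P.

Let monF : F \is monic.
Proof. by case: (aux_poly_monic (2 * e) b c (e ^+ 2) m2 (isT : 3 <= 3)%N). Qed.
Let sizeF : size F = (3 * m).+1.
Proof. by case: (aux_poly_monic (2 * e) b c (e ^+ 2) m2 (isT : 3 <= 3)%N) => _; rewrite mulnC. Qed.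

Let Fw : F = w * (w + e%:P) ^+ 2 + b%:P.
Proof. by rewrite /F aux_polyE // /f_at subSS subSS subn0 expr1. Qed.

Let Ff : F = f \Po w.
Proof.
by rewrite Fw /f comp_polyD comp_polyM rmorphXn /= comp_polyD !comp_polyC comp_polyX.
Qed.

Variables (L : fieldExtType rat) (theta r : L) (rs : seq L).
Hypotheses (minF : is_zminpoly theta F) (minFr : is_zminpoly r F).
Hypothesis dimL : \dim {:L} = (3 * m)%N.
Hypothesis splitF : map_poly intr F = \prod_(x <- rs) ('X - x%:P).
Hypothesis nconj : r ^+ m != theta ^+ m.

Let gen (x : L) : is_zminpoly x F -> <<1; x>>%VS = fullv.
Proof.
move=> minx; apply/eqP; rewrite eqEdim subvf dimL.
by rewrite (dim_zminpoly monF minx) sizeF /= leqnn.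
Qed.

Let om := theta ^+ m + c%:~R.
Let om2 := r ^+ m + c%:~R.

Let zevw (x : L) : zev x w = x ^+ m + c%:~R.
Proof. by rewrite /w rmorphD rmorphXn /= zevX zevC. Qed.

Let zevf (K : fieldType) (x : K) : zev x f = x * (x + e%:~R) ^+ 2 + b%:~R.
Proof. by rewrite /f !(rmorphD, rmorphM, rmorphXn) /= zevX !zevC. Qed.

Let f_om : om * (om + e%:~R) ^+ 2 + b%:~R = 0.
Proof. by rewrite -zevf /om -zevw -zev_comp -Ff; case: minF. Qed.

Let f_om2 : om2 * (om2 + e%:~R) ^+ 2 + b%:~R = 0.
Proof. by rewrite -zevf /om2 -zevw -zev_comp -Ff; case: minFr. Qed.

Let q_om2 : om2 ^+ 2 + (om + 2 * e%:~R) * om2 + (om + e%:~R) ^+ 2 = 0.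
Proof.
have ne : om2 - om != 0.
  by rewrite /om2 /om opprD addrACA subrr addr0 subr_eq0.
apply: (mulfI ne); rewrite mulr0 -[RHS](subrr 0) -{1}f_om2 -f_om; ring.
Qed.

(** The roots of f are [om], [om2] and [om3 = - 2 e - om - om2].  This is
    [f'(om) = (om - om2) (om - om3)] times [om2 - om3]. *)
Let delta := (om + e%:~R) * (3 * om + e%:~R) * (2 * om2 + om + 2 * e%:~R).

Lemma delta_sqr : delta ^+ 2 = (b * (4 * e ^+ 3 - 27 * b))%:~R.
Proof.
have eb : b%:~R = - (om * (om + e%:~R) ^+ 2) :> L.
  by apply/eqP; rewrite -addr_eq0 addrC f_om.
have e2 : (2 * om2 + om + 2 * e%:~R) ^+ 2 = - (om * (3 * om + 4 * e%:~R)).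
  apply/eqP; rewrite -subr_eq0 opprK.
  have -> : (2 * om2 + om + 2 * e%:~R) ^+ 2 + om * (3 * om + 4 * e%:~R) =
    4 * (om2 ^+ 2 + (om + 2 * e%:~R) * om2 + (om + e%:~R) ^+ 2) by ring.
  by rewrite q_om2 mulr0.
rewrite /delta [LHS]exprMn e2 !(intrM, intrB, rmorphXn) /= eb; ring.
Qed.

(** The factor [D] of [norm_form] is 1 modulo 2 by comparison of degrees.  If some
    irreducible [g] divided [A] and [B] modulo 2, the norm form, hence [F], would be
    in the square of [(2, g)]; so [A] and [B] are coprime modulo 2, and the descent
    applies. *)
Lemma no_unramified_quadratic (k : int) (eps : L) :
  regular_at 2 F -> eps ^+ 2 = eps + k%:~R -> eps \notin 1%VS -> False.
Proof.
move=> reg e2 eQ.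
have [A [B [D [eF sA A0 sB]]]] := norm_form monF minF (gen minF) splitF e2 eQ.
have F20 : redp 2 F != 0 by rewrite monic_neq0 // monic_map.
have sF2 : size (redp 2 F) = (3 * m).+1.
  by rewrite size_map_poly_id0 ?sizeF // (monicP monF) oner_eq0.
pose a2 := redp 2 A; pose b2 := redp 2 B.
have e2F : a2 ^+ 2 + (a2 * b2 + (- k%:~R)%:P * b2 ^+ 2) = redp 2 F * redp 2 D.
  by rewrite -[RHS]rmorphM -eF !(rmorphB, rmorphD, rmorphM, rmorphXn) /= map_polyC /= polyCN mulNr addrA.
have sA1 : (0 < size a2)%N by rewrite size_poly_gt0.
have sA2 : size (a2 ^+ 2) = (3 * m).+1.
  by rewrite -[LHS]prednK ?size_exp -/a2 ?muln2 ?sA ?dimL // size_poly_gt0 expf_neq0.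
have sr : (size (a2 * b2 + (- k%:~R)%:P * b2 ^+ 2)%R < size (a2 ^+ 2)%R)%N.
  rewrite sA2 ltnS; apply: leq_trans (size_polyD _ _) _; rewrite geq_max.
  have sb : (size b2 <= (size a2).-1)%N by rewrite -ltnS prednK.
  have sa : ((size a2).-1 + (size a2).-1 = 3 * m)%N by rewrite addnn sA.
  apply/andP; split.
    apply: leq_trans (size_polyMleq _ _) _; rewrite -(prednK sA1) addSn /= -sa.
    by rewrite leq_add2l.
  rewrite mul_polyC; apply: leq_trans (size_scale_leq _ _) _.
  apply: leq_trans (size_polyMleq _ _) _; rewrite -sa.
  by apply: leq_trans (leq_pred _) _; apply: leq_add.
have D1 : redp 2 D = 1.
  have D0 : redp 2 D != 0.
    apply/eqP => D0; move: e2F; rewrite D0 mulr0 => /eqP.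
    by rewrite -size_poly_eq0 size_polyDl // sA2.
  have : size (redp 2 D) = 1%N.
    have := congr1 (fun q : {poly 'F_2} => size q) e2F.
    rewrite size_polyDl // sA2 size_mul // sF2 addSn /= -addn1 => /addnI.
    by move=> <-.
  move/eqP/size_poly1P => [x x0 ->]; congr _%:P.
  by move: x0; case: x => [[|[|x]]] // i _; apply/val_inj.
rewrite D1 mulr1 addrA in e2F.
apply: (@norm_form_descent (redp 2 (aux_poly (2 * e) b c (e ^+ 2) 3 1)) (- k%:~R) m a2 b2).
- exact: ltnW.
- apply: coprime_irred => // g ig gA gB.
  have [G eG] := redp_surj g.
  have irG : irreducible_poly (redp 2 G) by rewrite eG.
  have PA : inI 2 G A by rewrite /inI eG.
  have PB : inI 2 G B by rewrite /inI eG.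
  have P2C : inI2 2 G (F * D).
    rewrite -eF; apply: inI2B; last by apply/inI2Ml/inI2X.
    by apply: inI2D; [apply: inI2X | apply: inI2M].
  have [D' eD] : exists D', D = 1 + 2%:R * D'.
    by apply: redp_eqP; rewrite // D1 rmorph1.
  have PF : inI 2 G F.
    have := inI2W (isT : prime 2) P2C; rewrite inIM // => /orP[//|].
    by rewrite eD addrC inIDr ?inIp // inI1.
  apply: (reg G irG); have -> : F = F * D - 2%:R * (F * D') by rewrite eD; ring.
  by apply: inI2B => //; apply: inI2p => //; apply: inIMr.
- by rewrite sA dimL.
rewrite e2F /F aux_poly_comp map_comp_poly /= map_polyXn //.
Qed.

Let monic_size_f : f \is monic /\ size f = 4%N.
Proof.
have mX : 'X + e%:P \is monic by rewrite monicXaddC.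
have mX2 : ('X + e%:P) ^+ 2 \is monic by rewrite monic_exp.
have mg : 'X * ('X + e%:P) ^+ 2 \is monic by rewrite monicMl ?monicX.
have s2 : size (('X + e%:P) ^+ 2) = 3%N.
  by rewrite -[LHS]prednK ?size_exp ?size_XaddC // size_poly_gt0 monic_neq0.
have sg : size ('X * ('X + e%:P) ^+ 2) = 4%N.
  by rewrite size_Mmonic ?polyX_eq0 // size_polyX s2.
have lt : (size b%:P < size ('X * ('X + e%:P) ^+ 2)%R)%N.
  by rewrite sg ltnS (leq_trans (size_polyC_leq1 _)).
by split; [rewrite monicE lead_coefDl // -monicE | rewrite size_polyDl].
Qed.

Let monf := monic_size_f.1.
Let sizef := monic_size_f.2.

(* If Y vanishes at om and has degree at most 2, then Y(w) vanishes at theta and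
   has a degree less than 3 m = deg F. *)
Let minf : is_zminpoly om f.
Proof.
split=> [|Y Y0]; first by rewrite zevf f_om.
pose R := Pdiv.CommonRing.rmodp Y f; pose Q := Pdiv.CommonRing.rdivp Y f.
have eY : Y = Q * f + R := Pdiv.RingMonic.rdivp_eq monf Y.
exists Q; rewrite mulrC eY; suff -> : R = 0 by rewrite addr0.
have f0 : zev om f = 0 by rewrite zevf f_om.
have R0 : zev om R = 0 by move: Y0; rewrite eY rmorphD rmorphM /= f0 mulr0 add0r.
have sR : (size R < 4)%N.
  by have := Pdiv.CommonRing.ltn_rmodpN0 Y (monic_neq0 monf); rewrite sizef.
have sw : size w = m.+1 by rewrite /w size_XnaddC // ltnW.
apply/eqP; rewrite -(@comp_poly_eq0 _ R w); last by rewrite sw ltnS ltnW.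
have [|D eD] := minF.2 (R \Po w); first by rewrite zev_comp zevw.
rewrite eD; apply/eqP; have [->|D0] := eqVneq D 0; first by rewrite mulr0.
have := size_comp_poly R w; rewrite eD size_monicM // sizeF sw.
move: D0; rewrite -size_poly_gt0; move: (size D) (size R) sR => x y.
by clear - m2; nia.
Qed.

(* Modulo 2, f is 'X ('X + e)^2.  The factor 'X + e gives 4 | b, as f is b modulo
   its square; the simple factor 'X is not in the derivative. *)
Let reg2f : ~~ (2 %| e)%Z -> (2 %| b)%Z -> ~~ (4 %| b)%Z -> regular_at 2 f.
Proof.
move=> ne pb n4 G irG hf; have p2 : prime 2 by [].
have hf' : inI2 2 G (f_at e b 3 'X) by rewrite /f_at subSS subSS subn0 expr1.
have hX : inI 2 G ('X + e%:P) -> False.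
  by move=> h; have := f_at_we p2 irG h hf'; rewrite (negPf n4).
have := inI2W p2 hf; rewrite /f addrC inIDr ?inIC // inIM // => /orP[h|/(inIX irG)//].
have := inI2_deriv p2 hf; rewrite /f derivD derivC addr0 derivM derivX mul1r.
by rewrite addrC inIDr; [move/(inIX irG) | apply: inIMr].
Qed.

(** If 2 exactly divides b and e is odd, then [f(2)] is divisible by 4, so that
    substitution of 2 for [om] maps Z[om] to Z/4.  Over Q(om), the two other
    roots of f give the factor [Phi = w^2 + (om + 2 e) w + (om + e)^2] of [F], of
    degree 2 m, and the minimal polynomial [P] of r divides it.  As r generates the
    field of degree 3 m, [P] has degree m.  Since f is regular at 2, odd multiples
    of [P] and [Phi / P] have coefficients in Z[om].  The substitution turns [Phi]
    into [(w + 1)^2 + 2 e (w + 1) + (e^2 + 2 e + 3)].  As 2 exactly divides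
    [e^2 + 2 e + 3], this is regular at 2 as an Eisenstein polynomial is, so that
    its two factors are coprime modulo 2, where their product is [(w + 1)^2].
    This contradicts [split_square_descent]. *)
Lemma two_dvd_e : (2 %| b)%Z -> ~~ (4 %| b)%Z -> (2 %| e)%Z.
Proof.
move=> pb n4; apply: contraT => ne; have p2 : prime 2 by [].
have m0 : (0 < m)%N by apply: ltnW.
pose E := <<1; om>>%AS.
pose P := minPoly E r.
have sP : size P = m.+1.
  have := size_minPoly_dim E (gen minFr).
  rewrite (dim_zminpoly monf minf) sizef dimL mulnC => /eqP; rewrite eqn_pmul2l // => /eqP<-.
  by rewrite prednK // size_poly_gt0 monic_neq0 // monic_minPoly.
have monP : P \is monic by apply: monic_minPoly.
pose W : {poly L} := map_poly intr w.
pose Phi := W ^+ 2 + (om + 2 * e%:~R)%:P * W + ((om + e%:~R) ^+ 2)%:P.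
have omE : om \in E by apply: memv_adjoin.
have ConE x : x \in E -> x%:P \is a polyOver E by move=> xE; rewrite polyOverC.
have eE : e%:~R \in E by apply: rpred_int.
have PhiE : Phi \is a polyOver E.
  apply: rpredD; first apply: rpredD.
  - by rewrite rpredX // polyOver_int.
  - apply: rpredM; last exact: polyOver_int.
    by apply: ConE; apply: rpredD => //; apply: rpredM => //; apply: rpred_nat.
  - by apply: ConE; rewrite rpredX // rpredD.
have WPhi : (W - om%:P) * Phi = map_poly intr F.
  have -> : map_poly intr F = W * (W + (e%:~R)%:P) ^+ 2 - om%:P * (om%:P + (e%:~R)%:P) ^+ 2.
    rewrite Fw rmorphD rmorphM rmorphXn (rmorphD _ w) /= !map_polyC /= -/W; congr (_ + _).
    rewrite -(polyCD om) -(rmorphXn polyC) -(polyCM om) -polyCN; congr _%:P.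
    by apply/eqP; rewrite -addr_eq0 addrC f_om.
  rewrite /Phi (polyCD om) (rmorphXn polyC) /= (polyCD om) (polyCM 2) (rmorph_nat polyC 2).
  exact: cubic_factor.
have monw : w \is monic by rewrite monicXnaddC.
have sw : size w = m.+1 by rewrite size_XnaddC.
have monWo : W - om%:P \is monic.
  have sW : size W = m.+1 by rewrite size_map_monic.
  rewrite monicE lead_coefDl ?size_polyN ?sW ?(leq_ltn_trans (size_polyC_leq1 _)) //.
  by rewrite -monicE monic_map.
have monPhi : Phi \is monic by rewrite -(monicMl _ monWo) WPhi monic_map.
have Phir : Phi.[r] = 0.
  have Wr : W.[r] = om2 by rewrite -[LHS]/(zev r w) zevw.
  by rewrite /Phi !(hornerD, hornerM, horner_exp, hornerC) Wr q_om2.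
have dvP : P %| Phi by apply: minPoly_dvdp => //; apply/rootP.
pose Q := Phi %/ P.
have PhiQ : Phi = Q * P by rewrite divpK.
have monQ : Q \is monic by rewrite -(monicMr _ monP) -PhiQ.
have dvF : Phi %| map_poly intr F by rewrite -WPhi dvdp_mull.
have [||N1 odd1 [P2 sP2 eP2]] := lift_poly minf monf p2 (reg2f ne pb n4) (P := P).
- exact: minPolyOver.
- by move=> i; apply: (integral_factorF monF splitF) => //; apply: dvdp_trans dvF.
have [||N2 odd2 [Q2 sQ2 eQ2]] := lift_poly minf monf p2 (reg2f ne pb n4) (P := Q).
- by apply: divp_polyOver => //; apply: minPolyOver.
- move=> i; apply: (integral_factorF monF splitF) => //; apply: dvdp_trans dvF.
  by rewrite PhiQ dvdp_mulr.
pose N := (N1 * N2)%N.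
(* Relations in Z[om] persist modulo 4 when 2 is substituted for om. *)
have ev4 (A : {poly int}) : zev om A = 0 -> exists k, ev A = 4 * k.
  move=> /minf.2[D ->].
  have [k ek] : exists k, ev f = 4 * k.
    have -> : ev f = 2 * (2 + e) ^+ 2 + b.
      by rewrite /horner_eval /f !(hornerD, hornerM, horner_exp, hornerC, hornerX).
    exact: mod4_root.
  by exists (k * ev D); rewrite mulrA -ek; apply: hornerM.
have ev_eq A N' : zev om A = N'%:R -> exists k, ev A = N'%:R + 4 * k.
  move=> eA; have [|k ek] := ev4 (A - N'%:R); first by rewrite rmorphB rmorph_nat /= eA subrr.
  by exists k; rewrite -ek rmorphB rmorph_nat /= addrCA subrr addr0.
pose w2 : {poly {poly int}} := map_poly polyC w.
pose y2 : {poly int} := 'X + (2 * e)%:P.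
pose z2 : {poly int} := ('X + e%:P) ^+ 2.
pose Phi2 := w2 ^+ 2 + y2%:P * w2 + z2%:P.
have mapPhi2 (R : comNzRingType) (g : {rmorphism {poly int} -> R}) :
    map_poly g Phi2 = map_poly (g \o polyC) w ^+ 2 + (g y2)%:P * map_poly (g \o polyC) w + (g z2)%:P.
  by rewrite /Phi2 rmorphD rmorphD rmorphM rmorphXn /= !map_polyC /w2 map_poly_comp.
have PhiZ : map_poly (zev om) Phi2 = Phi.
  rewrite mapPhi2 /Phi; congr (_ ^+ 2 + _%:P * _ + _%:P).
  - by apply: eq_map_poly => x /=; rewrite zevC.
  - by rewrite /y2 rmorphD /= zevX zevC intrM.
  - by apply: eq_map_poly => x /=; rewrite zevC.
  - by rewrite /z2 rmorphXn rmorphD /= zevX zevC.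
(* Phi2 is Phi with the variable of the inner polynomials in place of om, and Ph
   its image under the substitution of 2. *)
pose Ph : {poly int} := map_poly ev Phi2.
have PhiEv : Ph = w ^+ 2 + (2 + 2 * e)%:P * w + ((2 + e) ^+ 2)%:P.
  rewrite /Ph mapPhi2; congr (_ ^+ 2 + _%:P * _ + _%:P).
  - by apply: map_poly_id => x _ /=; rewrite /= /horner_eval hornerC.
  - by rewrite /y2 /= /horner_eval !(hornerD, hornerX, hornerC).
  - by apply: map_poly_id => x _ /=; rewrite /= /horner_eval hornerC.
  - by rewrite /z2 /= /horner_eval !(horner_exp, hornerD, hornerX, hornerC).
pose P4 := map_poly ev P2; pose Q4 := map_poly ev Q2.
(* The factor 4 is written as 2 * 2 to fit the criteria for membership in the
   square of (2, G). *)
have PQ4 : exists S, Q4 * P4 = N%:R * Ph + 2%:R * (2%:R * S).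
  have main i : exists k, (Q4 * P4 - N%:R * Ph)`_i = 4 * k.
    have -> : Q4 * P4 - N%:R * Ph = map_poly ev (Q2 * P2 - N%:R * Phi2).
        by rewrite /Ph rmorphB (rmorphM _ Q2) (rmorphM _ N%:R) rmorph_nat.
    rewrite coef_map; apply: ev4.
    rewrite -(coef_map (zev om)) rmorphB (rmorphM _ Q2) (rmorphM _ N%:R) rmorph_nat /=.
    rewrite PhiZ PhiQ.
    have -> : map_poly (zev om) P2 = N1%:R *: P.
      by apply/polyP => k; rewrite coef_map coefZ eP2.
    have -> : map_poly (zev om) Q2 = N2%:R *: Q.
      by apply/polyP => k; rewrite coef_map coefZ eQ2.
    by rewrite /N natrM -!mul_polyC !polyC_natr mulrACA [N2%:R * _]mulrC subrr coef0.
  have [S eS] := choice main.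
  exists (\poly_(i < size (Q4 * P4 - N%:R * Ph)) S i).
  apply/eqP; rewrite addrC -subr_eq; apply/eqP/polyP => i.
  have four (X : {poly int}) : 2%:R * (2%:R * X) = X *+ 4 by ring.
  rewrite four coefMn coef_poly; case: ltnP => [_|/(nth_default 0)->].
    by rewrite eS mulr_natl.
  by rewrite mul0rn.
have [S eS] := PQ4.
have N1F : (N1%:R : 'F_2) != 0 by rewrite -(dvdn_pcharf (pchar_Fp p2)).
have NF : ~~ (2 %| N)%N by rewrite Euclid_dvdM // negb_or odd1.
have oddN : odd N by move: NF; rewrite dvdn2 negbK.
have NE (R : comNzRingType) : N%:R = 1 + 2%:R * (N./2)%:R :> R.
  by rewrite -{1}(odd_double_half N) oddN natrD -mul2n natrM.
pose k0 := e ^+ 2 + 2 * e + 3.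
have PhiE2 : Ph = (w + 1) ^+ 2 + 2%:R * (e%:P * (w + 1)) + k0%:P.
  rewrite PhiEv /k0; move: w => x; rewrite !(polyCD, polyCM, rmorphXn) /=.
  by rewrite ?polyC1; ring.
have k0even : (2 %| k0)%Z by apply: sqr_2e_3_dvd2.
have Pk0 G : irreducible_poly (redp 2 G) -> inI 2 G k0%:P.
  by move=> irG; rewrite inIC.
have c2 : redp 2 (Ph) = redp 2 (w + 1) ^+ 2.
  have k02 : redp 2 k0%:P = 0.
    by apply/eqP; rewrite map_polyC /= polyC_eq0 (intr_Fp_eq0 p2).
  rewrite PhiE2 (rmorphD _ _ k0%:P) /= k02 addr0 (rmorphD _ (_ ^+ 2)) rmorphXn /=.
  rewrite (rmorphM _ 2%:R) rmorph_nat.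
  by rewrite (pcharf0 pchar2_polyF2) mul0r addr0.
have Pm : (redp 2 P4)`_m != 0.
  have Pm1 : P`_m = 1 by have := monicP monP; rewrite lead_coefE sP.
  have [|k ek] := ev_eq P2`_m N1; first by rewrite -eP2 Pm1 mulr1.
  rewrite !coef_map /= ek rmorphD rmorphM rmorph_nat /=.
  by rewrite (_ : 4%:~R = 0 :> 'F_2) ?mul0r ?addr0 //; apply/eqP.
have sP4 : size (redp 2 P4) = m.+1.
  apply/eqP; rewrite eqn_leq; apply/andP; split.
    by rewrite -sP (leq_trans _ sP2) // (leq_trans (size_poly _ _)) // size_poly.
  by rewrite ltnNge; apply: contra Pm => /(nth_default 0)->.
suff : False by [].
apply: (@split_square_descent (redp 2 ('X + (c + 1)%:P)) m (redp 2 P4) (redp 2 Q4)) => //.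
- apply: coprime_irred; first by rewrite -size_poly_eq0 sP4.
  move=> g ig gP gQ.
  have [G eG] := redp_surj g.
  have irG : irreducible_poly (redp 2 G) by rewrite eG.
  have PP : inI 2 G P4 by rewrite /inI eG.
  have PQ : inI 2 G Q4 by rewrite /inI eG.
  have two x : inI 2 G x -> inI2 2 G (2%:R * x) by apply: inI2p.
  have hN : inI2 2 G (N%:R * Ph).
    have -> : N%:R * Ph = Q4 * P4 - 2%:R * (2%:R * S) by rewrite eS addrK.
    by apply: inI2B; [apply: inI2M | apply/two/inIp].
  have PPhi : inI 2 G (Ph).
    have := inI2W p2 hN; rewrite NE mulrDl mul1r addrC inIDr //.
    by rewrite -mulrA; apply: inIp.
  have P2Phi : inI2 2 G (Ph).
    have -> : Ph = N%:R * Ph - 2%:R * ((N./2)%:R * Ph).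
      by rewrite NE; ring.
    by apply: inI2B => //; apply/two/inIMl.
  have Pw : inI 2 G (w + 1).
    apply: (@inIX _ _ irG _ 2).
    have -> : (w + 1) ^+ 2 = Ph - 2%:R * (e%:P * (w + 1)) - k0%:P by rewrite PhiE2; ring.
    by apply: inIB; [apply: inIB => //; apply: inIp | apply: Pk0].
  have /(inI2C p2 irG) : inI2 2 G k0%:P.
    have -> : k0%:P = Ph - (w + 1) ^+ 2 - 2%:R * (e%:P * (w + 1)).
      by rewrite PhiE2; ring.
    apply: inI2B; last by apply/two/inIMl.
    by apply: inI2B => //; apply: inI2X.
  by rewrite (negPf (sqr_2e_3_ndvd4 ne)).
- by rewrite sP4.
have := congr1 (fun q => redp 2 q) eS.
rewrite /= rmorphM [in RHS]rmorphD /= !(rmorphM _ _%:R) !rmorph_nat.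
rewrite (pcharf0 pchar2_polyF2) mul0r addr0 NE (pcharf0 pchar2_polyF2) mul0r addr0 mul1r /= c2.
rewrite mulrC => ->; congr (_ ^+ 2).
have -> : w + 1 = ('X + (c + 1)%:P) \Po 'X^m.
  by rewrite comp_polyD comp_polyX comp_polyC polyCD addrA.
by rewrite map_comp_poly map_polyXn.
Qed.

(* p exactly divides b (4 e^3 - 27 b), which is then not a square. *)
Let delta_notin p : prime p -> (p %| b)%Z -> ~~ ((p ^ 2)%N %| b)%Z ->
  ~~ (p %| 2)%N -> ~~ (p %| e)%Z -> delta \notin 1%VS.
Proof.
move=> pr pb npb np2 npe; apply/negP => /vlineP[q eq_].
have := delta_sqr; rewrite eq_ -(rmorph_int (in_alg L)) -[q *: 1]/(in_alg L q) -rmorphXn.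
move/fmorph_inj/int_square_dvd => /(_ p pr) h.
have /dvdzP[b' eb] := pb.
have /dvdzP[z ez] := h (dvdz_mulr _ pb).
have : (p %| b' * (4 * e ^+ 3 - 27 * b))%Z.
  apply/dvdzP; exists z; apply: (@mulfI _ (p : int)); first by case: (p) pr.
  by move: ez; set Y := _ - _; rewrite {1}eb -mulnn PoszM => ez; rewrite mulrA [p%:Z * _]mulrC ez; ring.
rewrite dvdzM_prime // => /orP[/dvdzP[y ey]|].
  by case/negP: npb; rewrite eb ey; apply/dvdzP; exists y; rewrite -mulnn PoszM mulrA.
rewrite rpredBr; last by apply: dvdz_mull.
have -> : 4 * e ^+ 3 = 2 ^+ 2 * e ^+ 3 by [].
rewrite dvdzM_prime // => /orP[] /(dvdzX_prime pr); last by rewrite (negPf npe).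
by rewrite dvdzE /= (negPf np2).
Qed.

(* 2 divides the degree 3 m of L. *)
Let even_m : delta \notin 1%VS -> (2 %| m)%N.
Proof.
move=> dQ; pose k := - (b * (4 * e ^+ 3 - 27 * b)).
have sT : size ('X^2 + k%:P : {poly int}) = 3%N by rewrite size_XnaddC.
have mT : ('X^2 + k%:P : {poly int}) \is monic by rewrite monicXnaddC.
have d2 : \dim <<1; delta>> = 2.
  apply: (dim_quadratic mT sT _ dQ).
  by rewrite rmorphD rmorphXn /= zevX zevC delta_sqr -intrD subrr.
have := field_dimS (subvf <<1; delta>>%AS); rewrite dimL d2.
by rewrite Gauss_dvdr.
Qed.

(* Modulo 2, a polynomial in X^m with m even is a square, so F' is 0; if the
   discriminant were odd, its Bezout relation would make F a unit modulo 2. *)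
Let disc_even : (2 %| m)%N -> (2 %| discriminant F)%Z.
Proof.
move=> m_even; apply: contraT => nd; have p2 : prime 2 by [].
have [u [v e2]] : exists u v, (discriminant F)%:P = u * F + v * F^`().
  by apply: discriminant_bezout => //; rewrite sizeF; clear - m2; lia.
have F'0 : redp 2 F^`() = 0.
  have eF2 : redp 2 F = (redp 2 (aux_poly (2 * e) b c (e ^+ 2) 3 1) \Po 'X^(m./2)) ^+ 2.
    by rewrite /F aux_poly_comp map_comp_poly map_polyXn /= -comp_polyXn_double even_halfK // -dvdn2.
  by rewrite -deriv_map eF2 deriv_sqr0.
have := congr1 (fun q => redp 2 q) e2.
rewrite /= rmorphD (rmorphM _ u) (rmorphM _ v) /= F'0 mulr0 addr0 map_polyC /= => eD.
have : redp 2 F %| ((discriminant F)%:~R)%:P by rewrite eD dvdp_mull.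
move/dvdp_leq; rewrite polyC_eq0 (intr_Fp_eq0 p2) nd => /(_ isT).
rewrite size_map_poly_id0 ?sizeF ?(monicP monF) ?oner_eq0 // leqNgt.
by rewrite (leq_ltn_trans (size_polyC_leq1 _)) // ltnS muln_gt0 /= ltnW.
Qed.

(** For odd p not dividing e, [delta] generates a quadratic field, so that m and
    the discriminant of [F] are even; the conditions other than (i) and (ii)
    exclude an even m at the prime 2.  In both cases [F] is regular at 2, and
    [delta^2] is a square times an integer congruent to 1 modulo 4, so that
    [eps = (1 + delta / s) / 2] is an algebraic integer. *)
Theorem cubic_dvd p : disc_primes_condition (2 * e) b c (e ^+ 2) 3 m ->
  prime p -> cond_i b p -> (p %| e)%Z.
Proof.
move=> hd pr [pb npb]; apply: contraT => npe.
have [p_2|p_odd] := eqVneq p 2%N.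
  by move: npe pb npb; rewrite p_2 => /negP npe pb npb; case: npe; apply: two_dvd_e.
have np2 : ~~ (p %| 2)%N by rewrite dvdn_prime2.
have dQ := delta_notin pr pb npb np2 npe.
have m_even := even_m dQ; have p2 : prime 2 by [].
have c2 : cond_i b 2 \/ cond_ii (2 * e) b c (e ^+ 2) 3 m 2.
  have [|[|[|[|]]]] := hd 2%N p2 (disc_even m_even); try by [left|right].
  - by case; rewrite dvdzM_prime // negb_or !dvdzE /= m_even andbF.
  - by case=> _; rewrite dvdzM_prime // negb_or !dvdzE /= m_even andbF.
  - by case; rewrite dvdzM_prime // negb_or !dvdzE /= m_even andbF.
have half : 2 != 0 :> L by rewrite -(rmorph_nat (in_alg L)) fmorph_eq0.
have [reg [k [s [s0 ek]]]] : regular_at 2 F /\ exists k s : int, s != 0 /\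
    b * (4 * e ^+ 3 - 27 * b) = s ^+ 2 * (1 + 4 * k).
  case: c2 => [[b2 n4]|c2].
    have e2 := two_dvd_e b2 n4; split.
      by rewrite /F aux_polyE // => G irG; apply: regular_i => //; rewrite e2.
    have [x ex] := int_even e2.
    have [y ey] := int_2mod4 b2 n4.
    (* s = 2, and (delta / 2)^2 = (2 y + 1) (16 x^3 - 27 (2 y + 1)). *)
    exists ((2 * y + 1) * (4 * x ^+ 3) - 27 * (y ^+ 2 + y) - 7), 2; split=> //.
    by rewrite ex ey; ring.
  split; first by move=> G irG; apply: regular_ii c2.
  have [nb _ _] := c2.
  have [y ey] := int_odd nb.
  exists (b * e ^+ 3 - 27 * (y ^+ 2 + y) - 7), 1; split=> //.
  by rewrite ey; ring.
pose eps := (1 + delta / s%:~R) / 2.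
have sL : s%:~R != 0 :> L by rewrite -(rmorph_int (in_alg L)) fmorph_eq0 intr_eq0.
suff [e1 e2] : eps ^+ 2 = eps + k%:~R /\ eps \notin 1%VS.
  by case: (no_unramified_quadratic reg e1 e2).
have d2 : delta ^+ 2 = s%:~R ^+ 2 * (1 + 4 * k%:~R).
  by rewrite delta_sqr ek intrM intrD intrM rmorphXn.
split.
  have -> : k%:~R = (delta ^+ 2 / s%:~R ^+ 2 - 1) / 4.
    by rewrite d2; field; rewrite sL -(rmorph_nat (in_alg L)) fmorph_eq0.
  by rewrite /eps; field; rewrite sL half -(rmorph_nat (in_alg L)) fmorph_eq0.
apply: contra dQ => he.
have -> : delta = s%:~R * (2 * eps - 1) by rewrite /eps; field; rewrite sL half.
have /vlineP[q ->] := he; apply/vlineP; exists (s%:~R * (2 * q - 1)).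
rewrite -[RHS]/(in_alg L _) -[q *: 1]/(in_alg L q).
by rewrite rmorphM rmorphB rmorphM rmorph1 rmorph_int rmorph_nat.
Qed.

End Cubic.

(** * The roots of F lie in Z[theta] *)

Lemma map_poly_intr_comp (K K' : nzRingType) (g : {rmorphism K -> K'}) (F : {poly int}) :
  map_poly g (map_poly intr F) = map_poly intr F.
Proof. by rewrite -map_poly_comp; apply: eq_map_poly => x /=; rewrite rmorph_int. Qed.

Lemma zev_morph (K K' : fieldType) (g : {rmorphism K -> K'}) x F :
  g (zev x F) = zev (g x) F.
Proof. by rewrite !zevE -horner_map map_poly_intr_comp. Qed.

(** In characteristic 0 the derivative of an irreducible polynomial is nonzero of
    smaller degree. *)
Lemma irreducible_separable (p : {poly rat}) : irreducible_poly p -> separable_poly p.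
Proof.
move=> irp; have p0 := irredp_neq0 irp; have [sp H] := irp.
rewrite unlock; apply: contraT => nc.
have /eqp_dvdl e := H _ nc (dvdp_gcdl _ _).
have pp' : p %| p^`() by rewrite -e dvdp_gcdr.
have p'0 : p^`() != 0.
  apply/eqP => /(congr1 (fun q : {poly rat} => q`_(size p).-2)); rewrite coef_deriv coef0.
  have -> : (size p).-2.+1 = (size p).-1 by rewrite prednK // -subn1 subn_gt0.
  by move/eqP; rewrite mulrn_eq0 -lead_coefE lead_coef_eq0 (negPf p0) orbF -subn1 subn_eq0 leqNgt sp.
by have := dvdp_leq p'0 pp'; rewrite leqNgt lt_size_deriv.
Qed.

Lemma separable_intr (K : fieldType) (iota : {rmorphism rat -> K}) (F : {poly int}) :
  irreducible_poly (map_poly intr F : {poly rat}) ->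
  separable_poly (map_poly intr F : {poly K}).
Proof.
by move=> /irreducible_separable; rewrite -(map_poly_intr_comp iota) separable_map.
Qed.

Section Roots.
Variables (K : numClosedFieldType) (F : {poly int}) (theta : K).
Hypothesis monF : F \is monic.
Let FQ : {poly rat} := map_poly intr F.
Hypothesis irF : irreducible_poly FQ.
Hypothesis F0 : zev theta F = 0.

Let rootF : root (map_poly ratr FQ) theta.
Proof. by rewrite map_poly_intr_comp; apply/rootP. Qed.

(** Q(theta) as an extension of finite degree of Q, in which subfields and their
    dimensions are available; in K they are not. *)
Definition Qtheta : fieldExtType rat := SubFieldExtType rootF irF.
Definition Qtheta_inj : {rmorphism Qtheta -> K} :=
  (subfx_inj : subFExtend ratr theta FQ -> K).

Lemma Qtheta_surj q : exists x, Qtheta_inj x = (map_poly ratr q).[theta].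
Proof.
exists (subfx_eval ratr theta FQ q).
exact: (subfx_inj_eval rootF (irredp_neq0 irF)).
Qed.

Lemma QthetaP x : exists q, Qtheta_inj x = (map_poly ratr q).[theta].
Proof.
have [q ->] := subfxE x; exists q.
exact: (subfx_inj_eval rootF (irredp_neq0 irF)).
Qed.

Lemma dim_Qtheta : \dim {:Qtheta} = (size F).-1.
Proof.
rewrite dimvf; apply: (congr1 predn); apply: size_map_inj_poly => //.
exact: intr_inj.
Qed.

End Roots.

Section Galois.
Variables (K : numClosedFieldType) (e b c : int) (n m : nat) (theta : K).
Hypotheses (n3 : (3 <= n)%N) (m2 : (2 <= m)%N).
Let F := aux_poly (2 * e) b c (e ^+ 2) n m.
Hypothesis irF : irreducible_poly (map_poly intr F : {poly rat}).
Hypothesis F0 : zev theta F = 0.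
Hypothesis splitting : forall x : K, root (map_poly intr F) x ->
  exists q : {poly rat}, x = (map_poly ratr q).[theta].
Hypothesis hdisc : disc_primes_condition (2 * e) b c (e ^+ 2) n m.

Let monF : F \is monic.
Proof. by case: (aux_poly_monic (2 * e) b c (e ^+ 2) m2 n3). Qed.
Let sizeF : size F = (m * n).+1.
Proof. by case: (aux_poly_monic (2 * e) b c (e ^+ 2) m2 n3). Qed.

(** All roots of [F] lie in Q(theta).  Only m of these 3 m simple roots have the
    same m-th power as theta, so another root r is available for [cubic_dvd]. *)
Lemma cubic_cond_i : n = 3%N -> forall p, prime p -> cond_i b p -> (p %| e)%Z.
Proof.
move=> en p pr hi; have hd := hdisc; rewrite en in hd.
pose L := Qtheta irF F0; pose j := Qtheta_inj irF F0.
have [rsC eC] := closed_field_poly_normal (map_poly intr F : {poly K}).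
rewrite (monicP (monic_map _ monF)) scale1r in eC.
have /choice[g hg] : forall x : K, exists y : L, x \in rsC -> j y = x.
  move=> x; have [xr|] := boolP (x \in rsC); last by exists 0.
  have [|q eq_] := splitting (x := x); first by rewrite eC root_prod_XsubC.
  by have [y ey] := Qtheta_surj irF F0 q; exists y => _; rewrite eq_ -ey.
pose rs := [seq g x | x <- rsC].
have splitF : map_poly intr F = \prod_(x <- rs) ('X - x%:P) :> {poly L}.
  apply: (map_poly_inj j); rewrite map_poly_intr_comp eC rmorph_prod big_map.
  rewrite big_seq [RHS]big_seq; apply: eq_bigr => x xr.
  by rewrite rmorphB /= map_polyX map_polyC /= hg.
have [tL etL] := Qtheta_surj irF F0 'X.
rewrite map_polyX hornerX in etL.
have min x : zev x F = 0 -> is_zminpoly (x : L) F.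
  exact: (irreducible_zminpoly (in_alg L)).
have tL0 : zev tL F = 0.
  by apply: (fmorph_inj j); rewrite zev_morph etL F0 rmorph0.
have dimL : \dim {:L} = (3 * m)%N by rewrite dim_Qtheta sizeF en mulnC.
have urs : uniq rs.
  rewrite -separable_prod_XsubC -splitF.
  exact: (separable_intr (in_alg L)).
have szrs : size rs = (3 * m)%N.
  have : size (map_poly intr F : {poly L}) = (3 * m).+1.
    by rewrite size_map_monic // sizeF en mulnC.
  by rewrite splitF size_prod_XsubC => -[].
have [r rrs nr] : exists2 r, r \in rs & r ^+ m != tL ^+ m.
  apply: contrapT => nex.
  have p0 : 'X^m - (tL ^+ m)%:P != 0 :> {poly L}.
    by rewrite monic_neq0 // monicXnsubC // ltnW.
  have al : all (root ('X^m - (tL ^+ m)%:P)) rs.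
    apply/allP => r rrs; rewrite rootE !hornerE subr_eq0.
    by apply: contrapT => /negP nr; apply: nex; exists r.
  have := max_poly_roots p0 al urs; rewrite szrs size_XnsubC ?(ltnW m2) //.
  by clear - m2; lia.
have r0 : zev r F = 0 by apply/rootP; rewrite splitF root_prod_XsubC.
move: (min _ tL0) (min _ r0) splitF hd; rewrite /F en => min1 min2 split1 hd.
exact: (cubic_dvd m2 min1 min2 dimL split1 nr hd pr hi).
Qed.

(** By [integral_denominator] at all primes, the algebraic integer x of Q(theta)
    has the denominator 1; the representation is then reduced modulo [F]. *)
Theorem roots_in_Ztheta (x : K) : root (map_poly intr F) x ->
  exists2 h : {poly int}, (size h <= m * n)%N & x = zev theta h.
Proof.
move=> Fx; have [q eq_] := splitting Fx.
have [M M0 [h eh]] := clear_denominators (ratr : {rmorphism rat -> K}) theta q.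
have minF := irreducible_zminpoly (ratr : {rmorphism rat -> K}) monF irF F0.
have it : integralOver (intr : int -> K) theta by exists F => //; apply/rootP.
have ix : integralOver (intr : int -> K) x by exists F.
rewrite -eq_ in eh.
have [N [h' [N0 e' hN]]] := integral_denominator minF (ratr : {rmorphism rat -> K}) monF it ix M0 eh.
have reg p (pr : prime p) := all_regular n3 m2 hdisc cubic_cond_i pr.
have N1 : N = 1%N.
  apply/eqP; rewrite eqn_leq N0 andbT leqNgt; apply/negP => /pdivP[p pr].
  by apply/negP/hN/reg.
pose R := Pdiv.CommonRing.rmodp h' F; pose Q := Pdiv.CommonRing.rdivp h' F.
have eh' : h' = Q * F + R := Pdiv.RingMonic.rdivp_eq monF h'.
exists R.
  by have := Pdiv.CommonRing.ltn_rmodpN0 h' (monic_neq0 monF); rewrite sizeF ltnS.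
by rewrite -[x]mul1r -[1]/(1%:R) -N1 e' eh' rmorphD rmorphM /= F0 mulr0 add0r.
Qed.

End Galois.

(** * Complex-valued functions of a real variable *)

Section ComplexDerivative.
Local Open Scope complex_scope.
Variable R : realType.
Local Notation C := R[i].
Local Notation Re := (@complex.Re R).
Local Notation Im := (@complex.Im R).
Implicit Types (y z : R -> C) (x : R) (k l u v : C).

Lemma cReD u v : Re (u + v) = Re u + Re v. Proof. by case: u v => [? ?] []. Qed.
Lemma cImD u v : Im (u + v) = Im u + Im v. Proof. by case: u v => [? ?] []. Qed.
Lemma cReM u v : Re (u * v) = Re u * Re v - Im u * Im v.
Proof. by case: u v => [? ?] []. Qed.
Lemma cImM u v : Im (u * v) = Re u * Im v + Im u * Re v.
Proof. by case: u v => [? ?] []. Qed.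
Lemma complex_eqP u v : Re u = Re v -> Im u = Im v -> u = v.
Proof. by case: u v => [? ?] [? ?] /= -> ->. Qed.

(** The relational form of [cderive]: it gives derivability and the value of the
    derivative together, as the closure rules for sums and products need. *)
Definition is_cderive y x l :=
  is_derive x 1 (Re \o y) (Re l) /\ is_derive x 1 (Im \o y) (Im l).

Lemma is_cderive_derivable y x l : is_cderive y x l -> cderivable y x.
Proof. by case=> h1 h2; split; [case: h1 | case: h2]. Qed.

Lemma is_cderiveE y x l : is_cderive y x l -> cderive y x = l.
Proof.
case=> h1 h2; rewrite /cderive !derive1E.
by apply: complex_eqP => /=; [case: h1 | case: h2].
Qed.

Lemma cderivableP y x : cderivable y x -> is_cderive y x (cderive y x).
Proof. by case=> h1 h2; split; apply: DeriveDef => //=; rewrite derive1E. Qed.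

Lemma is_cderive_eq y x l l' : is_cderive y x l -> l = l' -> is_cderive y x l'.
Proof. by move=> h <-. Qed.

Lemma is_cderive_cst k x : is_cderive (fun=> k) x 0.
Proof. by split; exact: is_derive_cst. Qed.

Lemma is_cderiveD y z x l l' : is_cderive y x l -> is_cderive z x l' ->
  is_cderive (fun t => y t + z t) x (l + l').
Proof.
move=> [h1 h2] [h3 h4]; split.
  have -> : Re \o (fun t => y t + z t) = (Re \o y) + (Re \o z) by apply/funext => t; rewrite /= cReD.
  by rewrite cReD; exact: is_deriveD.
have -> : Im \o (fun t => y t + z t) = (Im \o y) + (Im \o z) by apply/funext => t; rewrite /= cImD.
by rewrite cImD; exact: is_deriveD.
Qed.

Lemma is_cderiveM y z x l l' : is_cderive y x l -> is_cderive z x l' ->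
  is_cderive (fun t => y t * z t) x (l * z x + y x * l').
Proof.
move=> [h1 h2] [h3 h4]; split.
  have -> : Re \o (fun t => y t * z t) = (Re \o y) * (Re \o z) - (Im \o y) * (Im \o z).
    by apply/funext => t; rewrite /= cReM.
  apply: is_derive_eq; rewrite cReD !cReM /= /GRing.scale /=; ring.
have -> : Im \o (fun t => y t * z t) = (Re \o y) * (Im \o z) + (Im \o y) * (Re \o z).
  by apply/funext => t; rewrite /= cImM.
apply: is_derive_eq; rewrite cImD !cImM /= /GRing.scale /=; ring.
Qed.

Lemma is_cderiveZ k y x l : is_cderive y x l -> is_cderive (fun t => k * y t) x (k * l).
Proof.
by move=> h; apply: is_cderive_eq (is_cderiveM (is_cderive_cst k x) h) _; rewrite mul0r add0r.
Qed.

Lemma is_cderive_sum (I : Type) (s : seq I) (y : I -> R -> C) x (l : I -> C) :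
  (forall i, is_cderive (y i) x (l i)) ->
  is_cderive (fun t => \sum_(i <- s) y i t) x (\sum_(i <- s) l i).
Proof.
move=> h; elim: s => [|i s IH].
  rewrite big_nil (_ : (fun t => _) = fun=> 0); first exact: is_cderive_cst.
  by apply/funext => t; rewrite big_nil.
rewrite big_cons (_ : (fun t => _) = fun t => y i t + \sum_(j <- s) y j t).
  exact: is_cderiveD.
by apply/funext => t; rewrite big_cons.
Qed.

Lemma cexpD u v : cexp (u + v) = cexp u * cexp v.
Proof.
apply: complex_eqP; rewrite ?cReM ?cImM /cexp /= cReD cImD expRD ?cosD ?sinD; ring.
Qed.

Lemma cexp0 : cexp (0 : C) = 1.
Proof. by rewrite /cexp /= expR0 cos0 sin0 mulr1 mulr0. Qed.

Lemma cexp_sum (I : Type) (s : seq I) (u : I -> C) :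
  cexp (\sum_(i <- s) u i) = \prod_(i <- s) cexp (u i).
Proof. by elim: s => [|i s IH]; rewrite ?big_nil ?cexp0 // !big_cons cexpD IH. Qed.

Lemma is_cderive_cexp l x : is_cderive (fun t => cexp (l * t%:C)) x (l * cexp (l * x%:C)).
Proof.
have ReE t : Re (l * t%:C) = Re l * t by rewrite cReM /= mulr0 subr0.
have ImE t : Im (l * t%:C) = Im l * t by rewrite cImM /= mulr0 add0r.
have dl (a : R) : is_derive x 1 (fun t : R => a * t) a.
  have -> : (fun t : R => a * t) = a *: (@idfun R) by [].
  by apply: is_derive_eq; rewrite /GRing.scale /= mulr1.
have dexp : is_derive x 1 (fun t => expR (Re l * t)) (expR (Re l * x) * Re l).
  exact: (is_derive1_comp (is_derive_expR _) (dl _)).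
have dcos : is_derive x 1 (fun t => cos (Im l * t)) (- sin (Im l * x) * Im l).
  exact: (is_derive1_comp (is_derive_cos _) (dl _)).
have dsin : is_derive x 1 (fun t => sin (Im l * t)) (cos (Im l * x) * Im l).
  exact: (is_derive1_comp (is_derive_sin _) (dl _)).
split.
  have -> : Re \o (fun t => cexp (l * t%:C)) =
    (fun t => expR (Re l * t)) * (fun t => cos (Im l * t)).
    by apply/funext => t; rewrite /cexp /= ReE ImE.
  apply: is_derive_eq; rewrite cReM /= ReE ImE /GRing.scale /=; ring.
have -> : Im \o (fun t => cexp (l * t%:C)) =
  (fun t => expR (Re l * t)) * (fun t => sin (Im l * t)).
  by apply/funext => t; rewrite /cexp /= ReE ImE.
apply: is_derive_eq; rewrite cImM /= ReE ImE /GRing.scale /=; ring.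
Qed.

(** [g' = l g] forces [g(t) exp(- l t)] to have derivative 0. *)
Lemma first_order_solution l (g : R -> C) : (forall x, is_cderive g x (l * g x)) ->
  forall x, g x = g 0 * cexp (l * x%:C).
Proof.
move=> dg x; pose h t := cexp (- l * t%:C) * g t.
have dh t : is_cderive h t 0.
  apply: is_cderive_eq (is_cderiveM (is_cderive_cexp (- l) t) (dg t)) _; ring.
have hE : h x = h 0.
  apply: complex_eqP; [apply: (@is_derive_0_is_cst _ (Re \o h)) | apply: (@is_derive_0_is_cst _ (Im \o h))];
  by move=> t; case: (dh t).
have : h x * cexp (l * x%:C) = g x.
  by rewrite /h mulrAC -cexpD mulNr addNr cexp0 mul1r.
by move=> <-; rewrite hE /h mulr0 cexp0 mul1r.
Qed.

End ComplexDerivative.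

(** * Polynomials in d/dx *)

Section Operators.
Local Open Scope complex_scope.
Variable R : realType.
Local Notation C := R[i].
Implicit Types (y : R -> C) (p q : {poly C}).

(** The operator p(d/dx) applied to y. *)
Definition polyD p y (x : R) : C := \sum_(i < size p) p`_i * cderiven i y x.

Lemma polyD_wide N p y x : (size p <= N)%N ->
  polyD p y x = \sum_(i < N) p`_i * cderiven i y x.
Proof.
move=> le; rewrite /polyD (big_ord_widen N (fun i => p`_i * cderiven i y x)) // big_mkcond.
apply: eq_bigr => i _; case: ltnP => // /(nth_default 0)->.
by rewrite mul0r.
Qed.

Lemma polyDD p q y x : polyD (p + q) y x = polyD p y x + polyD q y x.
Proof.
pose N := maxn (size p) (size q).
rewrite !(@polyD_wide N) ?leq_maxl ?leq_maxr ?size_polyD // -big_split.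
by apply: eq_bigr => i _; rewrite coefD mulrDl.
Qed.

Lemma polyDZ k p y x : polyD (k *: p) y x = k * polyD p y x.
Proof.
rewrite (polyD_wide _ _ (size_scale_leq k p)) /polyD mulr_sumr.
by apply: eq_bigr => i _; rewrite coefZ mulrA.
Qed.

Lemma polyD0 y x : polyD 0 y x = 0.
Proof. by rewrite /polyD size_poly0 big_ord0. Qed.

Lemma polyD_sum (I : Type) (s : seq I) (p : I -> {poly C}) y x :
  polyD (\sum_(i <- s) p i) y x = \sum_(i <- s) polyD (p i) y x.
Proof.
by elim: s => [|i s IH]; rewrite ?big_nil ?polyD0 // !big_cons polyDD IH.
Qed.

Lemma polyD1 y x : polyD 1 y x = y x.
Proof. by rewrite /polyD size_poly1 big_ord1 coef1 mul1r. Qed.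

Lemma polyDC k y x : polyD k%:P y x = k * y x.
Proof. by rewrite -[k%:P]mulr1 mul_polyC polyDZ polyD1. Qed.

Definition smooth N y := forall k, (k < N)%N -> forall x, cderivable (cderiven k y) x.

Lemma is_cderive_polyD N p y x : smooth N y -> (size p <= N)%N ->
  is_cderive (polyD p y) x (polyD ('X * p) y x).
Proof.
move=> sm sp.
have -> : polyD ('X * p) y x = \sum_(i < size p) p`_i * cderiven i.+1 y x.
  rewrite (@polyD_wide (size p).+1); last first.
    by rewrite (leq_trans (size_polyMleq _ _)) // size_polyX.
  rewrite big_ord_recl coefXM mul0r add0r; apply: eq_bigr => i _.
  by rewrite coefXM.
apply: is_cderive_sum => i; apply: is_cderiveZ; apply: cderivableP.
by apply: sm; apply: leq_trans (ltn_ord i) sp.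
Qed.

Lemma cderiven_polyD N p y k : smooth N y -> (size p + k <= N.+1)%N ->
  cderiven k (polyD p y) = polyD ('X^k * p) y.
Proof.
move=> sm; elim: k => [|k IH] sp; first by rewrite expr0 mul1r.
have sp' : (size p + k <= N)%N by rewrite -ltnS -addnS.
apply/funext => x; rewrite /cderiven iterS -/(cderiven k _) IH ?(leqW sp') //.
apply: is_cderiveE; rewrite exprS -mulrA; apply: (is_cderive_polyD _ sm).
have [->|p0] := eqVneq p 0; first by rewrite mulr0 size_poly0.
by rewrite mulrC size_mulXn // addnC.
Qed.

Lemma diff_op_polyD N p y m (c : int) : smooth N y -> (size p + m <= N.+1)%N ->
  diff_op m c (polyD p y) = polyD (('X^m + (c%:~R)%:P) * p) y.
Proof.
move=> sm sp; apply/funext => x; rewrite /diff_op (cderiven_polyD sm sp).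
by rewrite mulrDl polyDD mul_polyC polyDZ.
Qed.

Lemma diff_op_powE N y m (c : int) k : (0 < m)%N -> smooth N y -> (m * k <= N)%N ->
  diff_op_pow m c k y = polyD (('X^m + (c%:~R)%:P) ^+ k) y.
Proof.
move=> m0 sm; elim: k => [|k IH] le; first by apply/funext => x; rewrite expr0 polyD1.
have le' : (m * k <= N)%N by rewrite (leq_trans _ le) // leq_mul2l leqnSn orbT.
rewrite /diff_op_pow iterS -/(diff_op_pow m c k y) IH // exprS.
apply: (diff_op_polyD _ sm).
have -> : size (('X^m + (c%:~R)%:P) ^+ k : {poly C}) = (m * k).+1.
  rewrite -[LHS]prednK ?size_exp ?size_XnaddC //.
  by rewrite size_poly_gt0 monic_neq0 // monic_exp // monicXnaddC.
by rewrite addSn ltnS addnC -mulnS.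
Qed.

Lemma is_solutionP a b c d n m y : (0 < m)%N -> (2 <= n)%N ->
  is_solution a b c d n m y <->
  smooth (m * n) y /\ forall x, polyD (map_poly intr (aux_poly a b c d n m)) y x = 0.
Proof.
move=> m0 n2; suff main : smooth (m * n) y -> forall x,
    diff_op_pow m c n y x + a%:~R * diff_op_pow m c n.-1 y x
      + d%:~R * diff_op_pow m c (n - 2) y x + b%:~R * y x =
    polyD (map_poly intr (aux_poly a b c d n m)) y x.
  by split=> -[sm e]; split=> // x; have := e x; rewrite main.
move=> sm x; rewrite !(diff_op_powE _ m0 sm) ?leq_mul2l ?leq_pred ?leq_subr ?leqnn ?orbT //.
rewrite /aux_poly !rmorphD /= !map_polyZ !rmorphXn rmorphD /= map_polyXn !map_polyC /=.
by rewrite !polyDD !polyDZ polyDC.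
Qed.

Lemma cderiven_exp_sum (N : nat) (r alpha : 'I_N -> C) k :
  cderiven k (fun x => \sum_(i < N) alpha i * cexp (r i * x%:C)) =
  (fun x => \sum_(i < N) alpha i * (r i ^+ k * cexp (r i * x%:C))).
Proof.
elim: k => [|k IH].
  by apply/funext => x; apply: eq_bigr => i _; rewrite expr0 mul1r.
apply/funext => x; rewrite /cderiven iterS -/(cderiven k _) IH.
apply: is_cderiveE; apply: is_cderive_sum => i; apply: is_cderiveZ.
by rewrite exprSr -mulrA; apply/is_cderiveZ/is_cderive_cexp.
Qed.

Lemma smooth_exp_sum (N M : nat) (r alpha : 'I_N -> C) :
  smooth M (fun x => \sum_(i < N) alpha i * cexp (r i * x%:C)).
Proof.
move=> k _ x; rewrite cderiven_exp_sum; apply: is_cderive_derivable.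
apply: is_cderive_sum => i; apply: is_cderiveZ; apply: is_cderiveZ.
exact: is_cderive_cexp.
Qed.

Lemma polyD_exp_sum (N : nat) (r alpha : 'I_N -> C) p x :
  polyD p (fun x => \sum_(i < N) alpha i * cexp (r i * x%:C)) x =
  \sum_(i < N) alpha i * (p.[r i] * cexp (r i * x%:C)).
Proof.
rewrite /polyD; under eq_bigr => k _ do rewrite cderiven_exp_sum mulr_sumr.
rewrite exchange_big /=; apply: eq_bigr => i _.
rewrite horner_coef mulr_suml mulr_sumr; apply: eq_bigr => k _.
by rewrite mulrCA !mulrA.
Qed.

(** With the Lagrange polynomials [L_i] of the roots, [sum L_i = 1] gives
    y = sum L_i(d/dx) y, and [L_i(d/dx) y] is killed by [d/dx - r_i]. *)
Lemma simple_roots_solution (N : nat) (r : 'I_N -> C) y : (0 < N)%N -> injective r ->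
  smooth N y ->
  (forall x, polyD (\prod_(i < N) ('X - (r i)%:P)) y x = 0) ->
  exists alpha : 'I_N -> C, forall x, y x = \sum_(i < N) alpha i * cexp (r i * x%:C).
Proof.
move=> N0 inj sm hF; set F := \prod_(i < N) _ in hF.
pose den i := \prod_(j < N | j != i) (r i - r j).
have den0 i : den i != 0.
  by apply/prodf_neq0 => j ji; rewrite subr_eq0 inj_eq // eq_sym.
pose L i : {poly C} := (den i)^-1 *: \prod_(j < N | j != i) ('X - (r j)%:P).
have LX i : ('X - (r i)%:P) * L i = (den i)^-1 *: F.
  by rewrite -scalerAr /F [in RHS](bigD1 i).
have sF : size F = N.+1.
  have -> : F = \prod_(i <- enum 'I_N) ('X - (r i)%:P) by rewrite big_enum.
  by rewrite size_prod_XsubC size_enum_ord.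
have sL i : (size (L i) <= N)%N.
  have := congr1 (fun q : {poly C} => size q) (LX i).
  rewrite size_scale ?invr_eq0 // sF.
  have [->|L0] := eqVneq (L i) 0; first by rewrite size_poly0.
  by rewrite size_monicM ?monicXsubC // size_XsubC => -[<-].
have LE i k : (L i).[r k] = (i == k)%:R.
  rewrite hornerZ horner_prod; have [->|ik] := eqVneq i k.
    rewrite (eq_bigr (fun j => r k - r j)) ?mulVf // => j _.
    by rewrite hornerXsubC.
  by rewrite (bigD1 k) 1?eq_sym //= hornerXsubC subrr mul0r mulr0.
have L1 : \sum_(i < N) L i = 1.
  apply/eqP; rewrite -subr_eq0; apply: contraT => S0.
  have ur : uniq [seq r i | i <- enum 'I_N] by rewrite map_inj_uniq ?enum_uniq.
  have al : all (root (\sum_(i < N) L i - 1)) [seq r i | i <- enum 'I_N].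
    apply/allP => _ /mapP[k _ ->]; rewrite rootE hornerD hornerN hornerC horner_sum.
    rewrite (bigD1 k) //= LE eqxx big1 ?addr0 ?subrr // => i ik.
    by rewrite LE (negPf ik).
  have := max_poly_roots S0 al ur; rewrite size_map size_enum_ord ltnNge => /negP[].
  apply: leq_trans (size_polyD _ _) _; rewrite size_polyN size_poly1 geq_max.
  apply/andP; split.
    by apply: leq_trans (size_sum _ _ _) _; apply/bigmax_leqP => i _; apply: sL.
  exact: N0.
pose g i x := polyD (L i) y x.
have dg i x : is_cderive (g i) x (r i * g i x).
  apply: is_cderive_eq (is_cderive_polyD x sm (sL i)) _.
  have -> : 'X * L i = r i *: L i + (den i)^-1 *: F.
    by rewrite -LX mulrBl mul_polyC addrC subrK.
  by rewrite polyDD (polyDZ (r i)) (polyDZ _ F) hF mulr0 addr0.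
exists (fun i => g i 0) => x.
rewrite -[LHS]polyD1 -L1 polyD_sum; apply: eq_bigr => i _.
exact: (first_order_solution (dg i)).
Qed.

End Operators.

(** * The general solution *)

Section Final.
Local Open Scope complex_scope.
Variable R : realType.
Local Notation C := R[i].

Lemma exp_formE (N : nat) (theta : C) (cc : 'I_N -> 'I_N -> int) (r alpha : 'I_N -> C) x :
  (forall i, r i = \sum_(j < N) (cc i j)%:~R * theta ^+ j) ->
  exp_form theta cc alpha x = \sum_(i < N) alpha i * cexp (r i * x%:C).
Proof.
move=> rE; apply: eq_bigr => i _; congr (_ * _).
by rewrite -cexp_sum rE mulr_suml.
Qed.

(** The image of the abstract field Q(theta) is one of the subfields that contain
    theta. *)
Lemma mem_adjoin_Q (F : {poly int}) (theta x : C) (monF : F \is monic)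
  (irF : irreducible_poly (map_poly intr F : {poly rat})) (F0 : zev theta F = 0) :
  adjoin_Q [set theta] x -> exists q : {poly rat}, x = (map_poly ratr q).[theta].
Proof.
pose A : set C := [set z | exists y, z = Qtheta_inj irF F0 y].
have AP z : z \in A -> exists y, z = Qtheta_inj irF F0 y by rewrite inE.
have PA y : Qtheta_inj irF F0 y \in A by rewrite inE; exists y.
move=> /(_ A) hx; have : A x.
  apply: hx; split; last first.
    by move=> _ ->; have [y ey] := Qtheta_surj irF F0 'X; exists y; rewrite ey map_polyX hornerX.
  split.
  - by rewrite -(rmorph1 (Qtheta_inj irF F0)) /=; apply: PA.
  - by move=> u v /AP[y ->] /AP[z ->]; rewrite -rmorphB; apply: PA.
  - by move=> u v /AP[y ->] /AP[z ->]; rewrite -fmorph_div; apply: PA.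
by case=> y ->; have [q ->] := QthetaP y; exists q.
Qed.

Lemma real_exp (r : C) (x : R) : complex.Im r = 0 ->
  cexp (r * x%:C) = (complex.Re (cexp (r * x%:C)))%:C.
Proof.
move=> r0; apply: complex_eqP => //=.
by rewrite /cexp cImM /= r0 mulr0 mul0r addr0 sin0 mulr0.
Qed.

Lemma Re_sum (I : Type) (s : seq I) (u : I -> C) :
  complex.Re (\sum_(i <- s) u i) = \sum_(i <- s) complex.Re (u i).
Proof. by elim: s => [|i s IH]; rewrite ?big_nil // !big_cons cReD IH. Qed.

Lemma real_horner (theta : C) (h : {poly int}) : complex.Im theta = 0 ->
  complex.Im (zev theta h) = 0.
Proof.
move=> t0; elim/poly_ind: h => [|h z IH]; first by rewrite rmorph0.
rewrite rmorphD rmorphM /= zevX zevC cImD cImM IH t0 mulr0 mul0r addr0 add0r.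
by rewrite -(rmorph_int (real_complex R)).
Qed.

End Final.

Theorem theorem2 (R : realType) (a b c d : int) (n m : nat) (theta : R[i])
  (ha : a ^+ 2 = 4 * d) (hn : (3 <= n)%N) (hm : (2 <= m)%N)
  (hirr : irreducible_over_Q (aux_poly a b c d n m))
  (hroot : croot (aux_poly a b c d n m) theta)
  (hsplit : is_splitting_field (aux_poly a b c d n m)
              (adjoin_Q [set theta]))
  (hdisc : disc_primes_condition a b c d n m) :
  general_solution_of_exp_form a b c d n m theta.
Proof.
have [e [ea ed]] := sqr_eq_4 ha.
have [monF sizeF] := aux_poly_monic a b c d hm hn.
set F := aux_poly a b c d n m in hirr hroot hsplit monF sizeF.
have F0 : zev theta F = 0 by apply/rootP.
have inQ x : root (map_poly intr F) x ->
    exists q : {poly rat}, x = (map_poly ratr q).[theta].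
  move=> xr; apply: (mem_adjoin_Q monF hirr F0); rewrite hsplit.
  exact: sub_gen_smallest.
have roots x : root (map_poly intr F) x ->
    exists2 h : {poly int}, (size h <= m * n)%N & x = zev theta h.
  move: hirr F0 inQ hdisc; rewrite /F ea ed => irF F0 inQ hd.
  exact: roots_in_Ztheta.
have [rs eF] := closed_field_poly_normal (map_poly intr F : {poly R[i]}).
rewrite (monicP (monic_map _ monF)) scale1r in eF.
have urs : uniq rs.
  by rewrite -separable_prod_XsubC -eF; apply: (separable_intr (ratr : {rmorphism rat -> R[i]})).
have szrs : size rs = (m * n)%N.
  apply: succn_inj; rewrite -sizeF -(size_prod_XsubC rs id) -eF.
  by rewrite size_map_poly_id0 // (monicP monF) oner_eq0.
pose r (i : 'I_(m * n)) := nth 0 rs i.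
have r_inj : injective r.
  by move=> i j /eqP; rewrite nth_uniq ?szrs // => /eqP/val_inj.
have r_root i : root (map_poly intr F) (r i).
  by rewrite eF root_prod_XsubC mem_nth // szrs.
have eFr : map_poly intr F = \prod_(i < m * n) ('X - (r i)%:P).
  by rewrite eF (big_nth 0) szrs big_mkord.
have /choice[h hE] : forall i, exists h : {poly int}, (size h <= m * n)%N /\ r i = zev theta h.
  by move=> i; have [h sh eh] := roots _ (r_root i); exists h.
have rE i : r i = \sum_(j < m * n) ((h i)`_j)%:~R * theta ^+ j.
  have [sh ->] := hE i; rewrite zevE (@horner_coef_wide _ (m * n)); last first.
    by rewrite (leq_trans (size_poly _ _)).
  by apply: eq_bigr => j _; rewrite coef_map.
have m0 : (0 < m)%N by apply: ltnW.
have n2 : (2 <= n)%N by apply: ltnW.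
have N0 : (0 < m * n)%N by rewrite muln_gt0 m0 (ltn_trans _ n2).
have gen y : is_solution a b c d n m y <->
    exists alpha : 'I_(m * n) -> R[i], forall x,
      y x = \sum_(i < m * n) alpha i * cexp (r i * real_complex R x).
  split=> [/(is_solutionP _ _ _ _ _ m0 n2)[sm hF]|[alpha /funext->]].
    by apply: simple_roots_solution => // x; rewrite -eFr hF.
  apply/(is_solutionP _ _ _ _ _ m0 n2); split; first exact: smooth_exp_sum.
  move=> x; rewrite polyD_exp_sum big1 // => i _.
  by rewrite (rootP (r_root i)) mul0r mulr0.
exists (fun i j => (h i)`_j); split.
  move=> y; rewrite gen; split=> -[alpha hy]; exists alpha => x.
    by rewrite (exp_formE _ _ rE).
  by rewrite hy (exp_formE _ _ rE).
move=> theta_real y; rewrite gen; split=> [[alpha hy]|[alpha hy]]; last first.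
  by exists (fun i => real_complex R (alpha i)) => x; rewrite hy (exp_formE _ _ rE).
(* For real theta the exponentials are real, so the real parts of the constants of
   a real solution represent it too. *)
exists (fun i => complex.Re (alpha i)) => x.
have r_real i : complex.Im (r i) = 0 by have [_ ->] := hE i; apply: real_horner.
rewrite (exp_formE _ _ rE).
transitivity (real_complex R (complex.Re (\sum_(i < m * n) alpha i * cexp (r i * real_complex R x)))).
  by rewrite -hy.
rewrite Re_sum rmorph_sum.
apply: eq_bigr => i _; rewrite (real_exp _ (r_real i)).
by rewrite cReM /= mulr0 subr0 rmorphM.
Qed.
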